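(* Let $p\in(0,1)$ and $\lambda=\min(p,1-p)$. Let $X_1,\dots,X_n$ be independent $p$-biased Bernoulli random variables normalized to have mean $0$ and variance $1$, and let $X=\sum_{i=1}^n a_iX_i$ with $a_i\in\mathbb{R}$. Let $Y$ be a degree $d$ polynomial in the $X_i$ which contains no degree $1$ monomials. Assume $\sum_{i=1}^n a_i^2=T$ and $a_i^2\le\delta$ for all $i$. Fix $\ell\in\mathbb{N}$, and set $\eta:=\|Y\|_2$ and, for real $t$, $\epsilon:=\exp\left[-2t^2(T-\delta d\ell)/\pi^2\right]$. Let $\varphi_X(t)=\mathbb{E}[e^{itX}]$ and $\varphi(t)=\mathbb{E}[e^{it(X+Y)}]$. Then for all $t$ such that $$|t|<\min\left(\sqrt{p(1-p)}\,\pi\,\delta^{-1/2},\ (2e)^{\frac{\ell}{2}}\lambda^{-\frac{\ell}{2}}\eta^{-1}\right)$$ it follows that $$|\varphi(t)-\varphi_X(t)|\le \ell\epsilon\left(1+\left|t\,\hat{\|}Y\hat{\|}_1\right|^\ell\right)+\frac{|t\eta|^{\ell+1}}{(\ell+1)!}\,\ell^{\frac{d(\ell+1)}{2}}\lambda^{d\left(\frac{1-\ell}{2}\right)}+\lambda^d\exp\left[-\frac{d\lambda}{2e}|t\eta|^{-2/d}\right]+|t\eta|^{\frac{\ell+1}{2}}\lambda^{\frac{3d-\ell}{4}}(\ell+1)\exp\left[-\frac{d\lambda}{4e}|t\eta|^{-2/d}\right].$$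
   Context: Each $X_i$ equals $\sqrt{(1-p)/p}$ with probability $p$ and $-\sqrt{p/(1-p)}$ with probability $1-p$. Polynomials in the $X_i$ are written in the orthonormal multilinear basis: $Y=\sum_{S\subset[n]}\hat Y(S)\prod_{i\in S}X_i$; a monomial $\prod_{i\in S}X_i$ has degree $|S|$, and the degree of $Y$ is the largest $|S|$ with $\hat Y(S)\ne0$. $\|Y\|_2=\sqrt{\mathbb{E}[Y^2]}$ and $\hat{\|}Y\hat{\|}_1=\sum_S|\hat Y(S)|$ (spectral $1$-norm). When $t\eta=0$, expressions $\exp[-c|t\eta|^{-2/d}]$ with $c>0$ are read as $0$. *)

(* Defs.v *)
From mathcomp Require Import all_boot all_order all_algebra.
From mathcomp Require Import complex.
From mathcomp Require Import all_classical all_reals all_analysis.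

Set Implicit Arguments.
Unset Strict Implicit.
Unset Printing Implicit Defensive.

Import Order.TTheory GRing.Theory Num.Theory.
Import numFieldNormedType.Exports.

Local Open Scope classical_set_scope.
Local Open Scope ring_scope.

(* The two values are distinct and carry total mass p + (1 - p) = 1, so this
   determines the law of Z: it has mean 0 and variance 1. *)
Definition biased_bernoulli (disp : measure_display)
    (Omega : measurableType disp) (R : realType) (P : probability Omega R)
    (p : R) (Z : Omega -> R) : Prop :=
  P [set w | Z w = Num.sqrt ((1 - p) / p)] = p%:E /\
  P [set w | Z w = - Num.sqrt (p / (1 - p))] = (1 - p)%:E.

(* Mutual independence: the product rule over every finite subfamily. *)
Definition mutually_independent (disp : measure_display)
    (Omega : measurableType disp) (R : realType) (P : probability Omega R)
    (n : nat) (X : 'I_n -> {RV P >-> R}) : Prop :=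
  forall (S : {set 'I_n}) (B : 'I_n -> set R),
    (forall i, i \in S -> measurable (B i)) ->
    P (\bigcap_(i in [set` S]) (X i @^-1` B i)) =
    (\prod_(i in S) P (X i @^-1` B i))%E.

Definition multilinear (R : realType) (Omega : Type) (n : nat)
    (Yhat : {set 'I_n} -> R) (X : 'I_n -> Omega -> R) (w : Omega) : R :=
  \sum_(S : {set 'I_n}) Yhat S * \prod_(i in S) X i w.

(* The zero polynomial gets degree 0. *)
Definition mdegree (R : realType) (n : nat) (Yhat : {set 'I_n} -> R) : nat :=
  (\max_(S : {set 'I_n} | Yhat S != 0%R) #|S|)%N.

Definition spectral_norm1 (R : realType) (n : nat)
    (Yhat : {set 'I_n} -> R) : R :=
  \sum_(S : {set 'I_n}) `|Yhat S|.

Definition norm2 (disp : measure_display) (Omega : measurableType disp)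
    (R : realType) (P : probability Omega R) (Z : Omega -> R) : R :=
  Num.sqrt (fine 'E_P[fun w => Z w ^+ 2]).

Definition cexpi (R : realType) (x : R) : R[i] := (cos x +i* sin x)%C.

Definition cexpectation (disp : measure_display) (Omega : measurableType disp)
    (R : realType) (P : probability Omega R) (Z : Omega -> R[i]) : R[i] :=
  (fine 'E_P[fun w => complex.Re (Z w)] +i*
   fine 'E_P[fun w => complex.Im (Z w)])%C.

Definition charfun (disp : measure_display) (Omega : measurableType disp)
    (R : realType) (P : probability Omega R) (Z : Omega -> R) (t : R) : R[i] :=
  cexpectation P (fun w => cexpi (t * Z w)).

(* exp[- c |x|^(-2/d)], extended by its limit 0 at x = 0 (powR would give
   0 `^ (- 2 / d) = 0, hence the value 1). *)
Definition exp_decay (R : realType) (d : nat) (c x : R) : R :=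
  if x == 0 then 0 else expR (- (c * `|x| `^ (- 2 / d%:R))).

(* Main.v *)
Require Import Defs.
From mathcomp Require Import all_boot all_order all_algebra.
From mathcomp Require Import complex.
From mathcomp Require Import ring lra zify.
From mathcomp Require Import all_classical all_reals all_analysis.
From mathcomp Require Import measurable_realfun measurable_fun_approximation.

Set Implicit Arguments.
Unset Strict Implicit.
Unset Printing Implicit Defensive.

Import Order.TTheory GRing.Theory Num.Theory.
Import numFieldNormedType.Exports.

Local Open Scope ring_scope.

(** Put lambda = min(p, 1-p), u = |t eta|, g = u^(2/d), so that g^d = u^2, and
b = lambda/(2 e g).  The third term of the bound is then
S3 = (lambda exp(-b))^d.  Let L = 2 t^2 T/pi^2, S2 the second term, and B the
spectral norm times |t|.

Expand exp(itY) by Taylor's formula around 0.  After rotating complex numbers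
onto the real axis by a phase th, one has to bound the mixed moments
M_j = E[cos(th + tX) (tY)^j] for all phases, and one absolute moment
E|tY|^r for the remainder.

The moment M_1 is bounded monomial by monomial: by independence, every
variable outside the monomial contributes a factor
|E exp(i s X_i)| <= exp(-2 s^2/pi^2) with s = t a_i, and a variable inside
contributes |E X_i exp(i s X_i)| <= 1.  This gives |M_1| <= epsilon B
(first_order).

For j >= 2 the same computation fails, as the higher moments of X_i exceed 1
when p differs from 1/2.  Instead, (tY)^j has degree at most dj, so that M_j
sees only the Fourier levels of exp(itX) up to dj.  Each variable keeps on
level 0 only the mass |E exp(i s X_i)|^2, whence the mass on low levels is
small: weighting level k by z^k costs a factor z^(-dj) and leaves a product over the
variables (lowdeg_wave).  The remaining factor E(tY)^(2j) is controlled by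
hypercontractivity (hypercontractive), proved by tensorizing a two-point
inequality (two_point).  Choosing z = j/(2(b + ln(1/lambda))) yields
|M_j| <= exp(-L) + S3 for 2 <= j <= 9b/10 (power_moment).

Summation against 1/j! leaves a fraction 1/r! of exp(-L) + S3 unused, where r
is the last order (sum_inv_fact).  If the expansion runs up to order 9b/10,
the remainder is at most S3 divided by a larger factorial (remainder_tail),
hence fits into the unused part; if it stops earlier, at order l, the
remainder is at most S2 (remainder_order).  The terms with epsilon and exp(-L) <= epsilon are collected in
epsilon (B + 1) <= l epsilon (1 + B^l), for l >= 2.  When l = 1 or b <= 20/9,
the expansion of order 2 is enough: its remainder u^2/2 equals S2 if l = 1, is at most
S2 if b < 3/10, and at most S3 otherwise (model_bound).

The comparison with S3, whose constants are fixed, leaves little slack.  It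
takes the hypercontractive constant with 2 lambda instead of lambda, and the
second-order term in 1 - G <= exp(-G - G^2/4) (damped_loss_le).

All this takes place on sequences of bits; expectation_bits moves the
expectations over to them.  When t eta = 0 the polynomial vanishes almost surely, and when
d = 0 it is constant; d = 1 is excluded by the absence of linear terms. *)

(** * The two-point hypercontractive inequality *)

Lemma ge0_derive_le (R : realType) (f df : R -> R) (a b : R) :
  a <= b -> (forall y : R, is_derive y 1 f (df y)) ->
  (forall y, a <= y <= b -> 0 <= df y) -> f a <= f b.
Proof.
move=> ab fdf df0.
have [c cab E] : exists2 c, c \in `[a, b]%R & f b - f a = df c * (b - a).
  apply: MVT_segment => //; apply: continuous_subspaceT => x.
  by apply: differentiable_continuous; apply/derivable1_diffP; case: (fdf x).
by rewrite -subr_ge0 E mulr_ge0 ?subr_ge0 // df0 //; move: cab; rewrite in_itv.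
Qed.

Section Isd.
Variable R : realType.
Implicit Types (f g : R -> R) (x a b c : R).

(** These pointwise rules restate the ones for functions, with the derived
function written as an abstraction: derivatives of explicit expressions are
then obtained by composing terms, and compared with is_derive_eq. *)
Lemma isdD f g x a b : is_derive x 1 f a -> is_derive x 1 g b ->
  is_derive x 1 (fun t => f t + g t) (a + b).
Proof. exact: is_deriveD. Qed.

Lemma isdB f g x a b : is_derive x 1 f a -> is_derive x 1 g b ->
  is_derive x 1 (fun t => f t - g t) (a - b).
Proof. exact: is_deriveB. Qed.

Lemma isdM f g x a b : is_derive x 1 f a -> is_derive x 1 g b ->
  is_derive x 1 (fun t => f t * g t) (a * g x + f x * b).
Proof.
move=> fa gb; have h := is_deriveM fa gb.
by apply: is_derive_eq h _; rewrite addrC [a * _]mulrC.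
Qed.

Lemma isdZ c f x a : is_derive x 1 f a -> is_derive x 1 (fun t => c * f t) (c * a).
Proof. exact: is_deriveZ. Qed.

Lemma isdX n f x a : is_derive x 1 f a ->
  is_derive x 1 (fun t => f t ^+ n) (n%:R * f x ^+ n.-1 * a).
Proof.
move=> fa; have h := is_deriveX n fa; have -> // : (fun t => f t ^+ n) = f ^+ n.
by apply/funext => t; rewrite fctE.
Qed.

Lemma isdV f x a : f x != 0 -> is_derive x 1 f a ->
  is_derive x 1 (fun t => (f t)^-1) (- (f x) ^- 2 * a).
Proof. exact: is_deriveV. Qed.

Lemma isd_cst c x : is_derive x 1 (fun _ : R => c) 0.
Proof. exact: is_derive_cst. Qed.

Lemma isd_id x : is_derive x 1 (fun t : R => t) 1.
Proof. exact: is_derive_id. Qed.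

Lemma isd_aff c d x : is_derive x 1 (fun t => c + t * d) d.
Proof.
have h := isdD (isd_cst c x) (isdM (isd_id x) (isd_cst d x)).
by apply: is_derive_eq h _; rewrite mul1r mulr0 addr0 add0r.
Qed.
End Isd.

(** Young's inequality with exponents (k+1)/k and k+1. *)
Lemma young_pow (R : realDomainType) (k : nat) (x y : R) : 0 <= x -> 0 <= y ->
  k.+1%:R * (x ^+ k * y) <= k%:R * x ^+ k.+1 + y ^+ k.+1.
Proof.
move=> x0 y0; elim: k => [|k IH]; first by rewrite expr0 expr1; lra.
have h : 0 <= (x ^+ k.+1 - y ^+ k.+1) * (x - y).
  have [xy|/ltW yx] := leP x y.
    by apply: mulr_le0; rewrite subr_le0 // lerXn2r.
  by apply: mulr_ge0; rewrite subr_ge0 // lerXn2r.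
have := ler_wpM2l x0 IH.
move: h; rewrite !exprS -[k.+2%:R]natr1 -[k.+1%:R]natr1.
by set u := x ^+ k; set v := y ^+ k; nra.
Qed.

(** The sum is the divided difference of x^(2k+1), that is 2k+1 times the mean of
x^(2k) between a and b, and the mean of a convex function is at most the
average of its end values.  Algebraically, the terms i and 2k-i together are
at most a^(2k) + b^(2k) by rearrangement. *)
Lemma geom_sum_le (R : realDomainType) (k : nat) (a b : R) :
  \sum_(i < k.*2.+1) a ^+ (k.*2 - i) * b ^+ i *+ 2 <=
  k.*2.+1%:R * (a ^+ k.*2 + b ^+ k.*2).
Proof.
have pw (x : R) : `|x| ^+ k.*2 = x ^+ k.*2.
  by rewrite -muln2 mulnC !exprM real_normK ?num_real.
have -> : k.*2.+1%:R * (a ^+ k.*2 + b ^+ k.*2) =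
    \sum_(i < k.*2.+1) (a ^+ k.*2 + b ^+ k.*2).
  by rewrite sumr_const card_ord mulr_natl.
rewrite sumrMnl mulr2n {2}(reindex_inj rev_ord_inj) /= -big_split /=.
apply: ler_sum => i _.
have ik : (i <= k.*2)%N by rewrite -ltnS.
rewrite subSS subKn // -[a ^+ k.*2]pw -[b ^+ k.*2]pw.
have -> : `|a| ^+ k.*2 = `|a| ^+ (k.*2 - i) * `|a| ^+ i by rewrite -exprD subnK.
have -> : `|b| ^+ k.*2 = `|b| ^+ (k.*2 - i) * `|b| ^+ i by rewrite -exprD subnK.
have h (m n : nat) : a ^+ m * b ^+ n <= `|a| ^+ m * `|b| ^+ n.
  by rewrite -!normrX -normrM ler_norm.
have h1 := h (k.*2 - i)%N i; have h2 := h i (k.*2 - i)%N.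
have h3 : 0 <= (`|a| ^+ (k.*2 - i) - `|b| ^+ (k.*2 - i)) * (`|a| ^+ i - `|b| ^+ i).
  have [ab|/ltW ab] := leP `|a| `|b|.
    by apply: mulr_le0; rewrite subr_le0 lerXn2r ?nnegrE.
  by apply: mulr_ge0; rewrite subr_ge0 lerXn2r ?nnegrE.
by lra.
Qed.

Section TwoPoint.
Variables (R : realType) (p : R) (hp : 0 < p < 1).
Let q := 1 - p.
Let x1 := Num.sqrt (q / p).
Let x2 := - Num.sqrt (p / q).
Let lam := Num.min p q.

Lemma lam_gt0 : 0 < lam.
Proof. by rewrite /lam lt_min /q; case/andP: hp => *; apply/andP; split; lra. Qed.

Lemma lam_le : 2 * lam <= 1.
Proof. rewrite /lam /q; case: (leP p (1 - p)) => ?; lra. Qed.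

Lemma x1_sqr : x1 ^+ 2 = q / p.
Proof. by rewrite sqr_sqrtr // divr_ge0 ?subr_ge0 ?ltW //; case/andP: hp. Qed.

Lemma x2_sqr : x2 ^+ 2 = p / q.
Proof. by rewrite sqrrN sqr_sqrtr // divr_ge0 ?subr_ge0 ?ltW //; case/andP: hp. Qed.

Lemma px1 : p * x1 = Num.sqrt (p * q).
Proof.
case/andP: hp => p0 p1; have q0 : 0 < q by rewrite subr_gt0.
rewrite -{1}(ger0_norm (ltW p0)) -sqrtr_sqr -sqrtrM ?sqr_ge0 //.
by congr Num.sqrt; rewrite expr2 -mulrA; congr (_ * _); field; rewrite gt_eqF.
Qed.

Lemma qx2 : q * x2 = - Num.sqrt (p * q).
Proof.
case/andP: hp => p0 p1; have q0 : 0 < q by rewrite subr_gt0.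
rewrite mulrN -{1}(ger0_norm (ltW q0)) -sqrtr_sqr -sqrtrM ?sqr_ge0 //.
by congr (- Num.sqrt _); field; rewrite gt_eqF.
Qed.

Lemma sqrtpq_x12 : Num.sqrt (p * q) * (x1 - x2) = 1.
Proof.
case/andP: hp => p0 p1; have q0 : 0 < q by rewrite subr_gt0.
rewrite mulrBr -{1}px1 -[X in _ - X * _]opprK -qx2 mulNr opprK -!mulrA -!expr2.
by rewrite x1_sqr x2_sqr mulrC divfK ?gt_eqF // mulrC divfK ?gt_eqF // /q subrK.
Qed.

(** For the moment of order 2m with m = k+1 and tau = (2 lambda)^(1/m), this is
(2m-1) (2 lambda)^(1/m - 1). *)
Definition hyper_const (tau : R) (k : nat) : R := k.*2.+1%:R * (tau / (2 * lam)).

Variables (tau : R) (k : nat).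
Hypotheses (tau0 : 0 < tau) (tauE : tau ^+ k.+1 = 2 * lam).
Let K := hyper_const tau k.

(** This is the sign of the derivative in two_point_pos: a and b stand for the two
values of the linear form, the sum for the divided difference of x^(2k+1), and
G for the quadratic form of the right-hand side.  The divided difference is
bounded by the trapezoid average a^(2k) + b^(2k), Young's inequality against
G/tau homogenizes the product with G, and p, q >= lambda absorbs the loss. *)
Lemma hyper_deriv (a b G : R) : 0 < G ->
  k.+1%:R * (\sum_(i < k.*2.+1) a ^+ (k.*2 - i) * b ^+ i) * G <=
  K * (G ^+ k.+1 + k%:R * (p * a ^+ k.+1.*2 + q * b ^+ k.+1.*2)).
Proof.
move=> G0.
have l0 := lam_gt0; have lp : lam <= p by rewrite /lam ge_min lexx.
have lq : lam <= q by rewrite /lam ge_min lexx orbT.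
have GG : G = tau * (G / tau) by rewrite mulrC divfK // gt_eqF.
have y0 : 0 <= G / tau by rewrite divr_ge0 ?ltW.
have pw (x : R) m : x ^+ m.*2 = (x ^+ 2) ^+ m by rewrite -exprM mulnC muln2.
have ya := young_pow k (sqr_ge0 a) y0; have yb := young_pow k (sqr_ge0 b) y0.
have gs := geom_sum_le k a b.
have k0 : 0 <= k.+1%:R * G by rewrite mulr_ge0 // ltW.
have := ler_wpM2r k0 gs; rewrite sumrMnl -[_ *+ 2]mulr_natr => {}gs.
have Gk : G ^+ k.+1 = 2 * lam * (G / tau) ^+ k.+1.
  by rewrite {1}GG exprMn tauE.
rewrite Gk /K /hyper_const.
have A0 : 0 <= (a ^+ 2) ^+ k.+1 by rewrite exprn_ge0 // sqr_ge0.
have B0 : 0 <= (b ^+ 2) ^+ k.+1 by rewrite exprn_ge0 // sqr_ge0.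
rewrite !pw in gs *.
set S := \sum_(i < _) _ in gs *; set A := (a ^+ 2) ^+ k.+1 in ya A0 *.
set B := (b ^+ 2) ^+ k.+1 in yb B0 *; set Y := (G / tau) ^+ k.+1 in ya yb *.
set Ak := (a ^+ 2) ^+ k in ya gs; set Bk := (b ^+ 2) ^+ k in yb gs.
set N : R := k.*2.+1%:R in gs *; set c : R := k.+1%:R in gs ya yb *.
have N0 : 0 <= N by [].
rewrite -(ler_pM2r (_ : 0 < 2)) //.
apply: le_trans (_ : N * (Ak + Bk) * (c * G) <= _); first by apply: le_trans gs; lra.
have -> : N * (tau / (2 * lam)) * (2 * lam * Y + k%:R * (p * A + q * B)) * 2 =
  N * (tau * (2 * Y + k%:R * (p * A + q * B) / lam)).
  by field; rewrite gt_eqF.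
rewrite -mulrA ler_wpM2l //.
have -> : (Ak + Bk) * (c * G) = tau * (c * (Ak * (G / tau)) + c * (Bk * (G / tau))).
  by field; rewrite gt_eqF.
rewrite ler_pM2l //.
apply: le_trans (lerD ya yb) _.
have kk : k%:R * (A + B) <= k%:R * (p * A + q * B) / lam.
  rewrite ler_pdivlMr // -mulrA ler_wpM2l // mulrDl.
  by apply: lerD; rewrite mulrC ler_wpM2r.
by lra.
Qed.

Lemma is_derive_two_point (al be : R) :
  is_derive be 1
    (fun t => p * (al + t * x1) ^+ k.+1.*2 + q * (al + t * x2) ^+ k.+1.*2)
    (2 * be * (k.+1%:R * (\sum_(i < k.*2.+1)
       (al + be * x1) ^+ (k.*2 - i) * (al + be * x2) ^+ i))).
Proof.
have h := isdD (isdZ p (isdX k.+1.*2 (isd_aff al x1 be)))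
               (isdZ q (isdX k.+1.*2 (isd_aff al x2 be))).
apply: is_derive_eq h _; rewrite doubleS /=.
have H := @subrXX R (al + be * x1) (al + be * x2) k.*2.+1; rewrite /= in H.
set S := \sum_(i < _) _ in H *.
set a := _ ^+ k.*2.+1 in H *; set b := (al + be * x2) ^+ _ in H *.
have -> : p * (k.*2.+2%:R * a * x1) + q * (k.*2.+2%:R * b * x2) =
  k.*2.+2%:R * ((p * x1) * a + (q * x2) * b) by ring.
rewrite px1 qx2 mulNr -mulrBr H.
have -> : al + be * x1 - (al + be * x2) = be * (x1 - x2) by ring.
have -> : k.*2.+2%:R = 2 * k.+1%:R :> R by rewrite -natrM mul2n.
transitivity (2 * k.+1%:R * be * (Num.sqrt (p * q) * (x1 - x2)) * S); first by ring.
by rewrite sqrtpq_x12; ring.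
Qed.

(** With f the left-hand side as a function of be and G = al^2 + K be^2, the claim
is f <= G^(k+1), or f/G^k <= G.  Equality holds at be = 0, and G - f/G^k is
nondecreasing; dividing by G^k keeps all terms of the derivative of the same
degree in G and f, within the reach of Young's inequality. *)
Lemma two_point_pos (al be : R) : al != 0 -> 0 <= be ->
  p * (al + be * x1) ^+ k.+1.*2 + q * (al + be * x2) ^+ k.+1.*2 <=
  (al ^+ 2 + K * be ^+ 2) ^+ k.+1.
Proof.
move=> al0 be0.
have K0 : 0 <= K.
  by rewrite /K /hyper_const mulr_ge0 // divr_ge0 ?ltW // mulr_gt0 // lam_gt0.
pose f (t : R) : R := p * (al + t * x1) ^+ k.+1.*2 + q * (al + t * x2) ^+ k.+1.*2.
pose S (t : R) : R := \sum_(i < k.*2.+1) (al + t * x1) ^+ (k.*2 - i) * (al + t * x2) ^+ i.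
pose G (t : R) : R := al ^+ 2 + K * t ^+ 2.
have G0 t : 0 < G t.
  by apply: ltr_wpDr; [rewrite mulr_ge0 ?sqr_ge0|rewrite exprn_even_gt0].
have dG (t : R) : is_derive t 1 G (2 * K * t).
  have h := isdD (isd_cst (al ^+ 2) t) (isdZ K (isdX 2 (isd_id t))).
  by apply: is_derive_eq h _; rewrite /= expr1; ring.
have df (t : R) : is_derive t 1 f (2 * t * (k.+1%:R * S t)).
  exact: is_derive_two_point.
have dP (t : R) : is_derive t 1 (fun t => G t - f t * (G t ^+ k)^-1)
   ((2 * t / G t ^+ k.+1) * (K * (G t ^+ k.+1 + k%:R * f t) - k.+1%:R * S t * G t)).
  have Gk : G t ^+ k != 0 by rewrite expf_neq0 // gt_eqF.
  have h := isdB (dG t) (isdM (df t) (isdV (f := fun s => G s ^+ k) Gk (isdX k (dG t)))).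
  apply: is_derive_eq h _.
  have Gt := G0 t; move: (f t) (G t) (S t) Gt {Gk} => F g s g0.
  case: k => [|m] /=; first by rewrite !expr0 !expr1; field; rewrite gt_eqF.
  rewrite !exprS -[m.+2%:R]natr1 -[m.+1%:R]natr1; field.
  by rewrite expf_neq0 gt_eqF.
have {dP} : G 0 - f 0 / G 0 ^+ k <= G be - f be / G be ^+ k.
  apply: (ge0_derive_le be0 dP) => y /andP[y0 _].
  apply: mulr_ge0; first by rewrite divr_ge0 ?exprn_ge0 ?(ltW (G0 _)) ?mulr_ge0.
  by rewrite subr_ge0 hyper_deriv.
have -> : G 0 - f 0 / G 0 ^+ k = 0.
  rewrite /f /G !mul0r expr0n mulr0 !addr0 -mulrDl /q subrKC mul1r.
  by rewrite -muln2 mulnC exprM [_ ^+ k.+1]exprS mulfK ?subrr // !expf_neq0.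
by rewrite subr_ge0 ler_pdivrMr ?exprn_gt0 // -exprS.
Qed.
End TwoPoint.

(** The two-point hypercontractive inequality.  Signs reduce to two_point_pos, except
that al = 0 makes G vanish at be = 0 and is checked on the explicit values. *)
Lemma two_point (R : realType) (p : R) (tau : R) (k : nat) : 0 < p < 1 ->
  0 < tau -> tau ^+ k.+1 = 2 * Num.min p (1 - p) -> forall al be : R,
  p * (al + be * Num.sqrt ((1 - p) / p)) ^+ k.+1.*2 +
  (1 - p) * (al + be * - Num.sqrt (p / (1 - p))) ^+ k.+1.*2 <=
  (al ^+ 2 + hyper_const p tau k * be ^+ 2) ^+ k.+1.
Proof.
move=> hp tau0 tauE.
have nn (al be : R) : al != 0 ->
  p * (al + be * Num.sqrt ((1 - p) / p)) ^+ k.+1.*2 +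
  (1 - p) * (al + be * - Num.sqrt (p / (1 - p))) ^+ k.+1.*2 <=
  (al ^+ 2 + hyper_const p tau k * be ^+ 2) ^+ k.+1.
  move=> al0; have [be0|/ltW be0] := leP 0 be; first exact: two_point_pos.
  have pw (x y : R) : (al + be * x) ^+ k.+1.*2 = (- al + - be * x) ^+ k.+1.*2.
    by rewrite mulNr -opprD -[in RHS]mul2n exprM sqrrN -exprM mul2n.
  rewrite !pw // -(sqrrN al) -(sqrrN be).
  by apply: two_point_pos; rewrite ?oppr_eq0 ?oppr_ge0.
move=> al be; have [->|/nn//] := eqVneq al 0.
rewrite !add0r expr0n add0r.
have lam0 := lam_gt0 hp; have l2 := lam_le p.
have := x1_sqr hp; have := x2_sqr hp.
set x1 := Num.sqrt _; set x2 := - Num.sqrt _ => x2E x1E.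
have [p0 p1] := andP hp; have q0 : 0 < 1 - p by rewrite subr_gt0.
have lp : Num.min p (1 - p) <= p by rewrite ge_min lexx.
have lq : Num.min p (1 - p) <= 1 - p by rewrite ge_min lexx orbT.
have {tauE} KE : hyper_const p tau k ^+ k.+1 =
    k.*2.+1%:R ^+ k.+1 / (2 * Num.min p (1 - p)) ^+ k.
  have := lam0; rewrite /hyper_const exprMn expr_div_n tauE; set lam := Num.min p _ => l0.
  by rewrite [(2 * lam) ^+ k.+1]exprS; field; rewrite ?expf_neq0 ?mulf_neq0 ?gt_eqF.
set lam := Num.min p _ in lam0 l2 lp lq KE *.
have pw (x : R) : x ^+ k.+1.*2 = (x ^+ 2) ^+ k.+1 by rewrite -exprM mul2n.
set K := hyper_const p tau k in KE *.
rewrite !pw ![(be * _) ^+ 2]exprMn ![(be ^+ 2 * _) ^+ k.+1]exprMn [(K * _) ^+ _]exprMn KE.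
have -> : x2 ^+ 2 = p / (1 - p) by [].
rewrite x1E mulrCA [X in _ + X]mulrCA -mulrDr mulrC.
rewrite ler_wpM2r //; first by rewrite exprn_ge0 // sqr_ge0.
have bnd (x y : R) : 0 < y -> x <= 1 -> 0 <= x -> lam <= y -> y * (x / y) ^+ k.+1 <= x / lam ^+ k.
  move=> y0 x1' x0 ly; rewrite exprSr mulrCA [y * _]mulrC divfK ?gt_eqF // mulrC.
  rewrite ler_wpM2l // expr_div_n ler_pdivrMr ?exprn_gt0 // mulrC ler_pdivlMr ?exprn_gt0 //.
  apply: (le_trans (y := lam ^+ k)); first by rewrite ler_piMl ?exprn_ge0 ?(ltW lam0) // exprn_ile1.
  by rewrite lerXn2r ?nnegrE ?(ltW lam0) ?(ltW y0).
apply: le_trans (lerD (bnd (1 - p) p p0 _ _ lp) (bnd p (1 - p) q0 _ _ lq)) _; try lra.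
rewrite -mulrDl subrK exprMn invfM mulrA ler_pM2r ?invr_gt0 ?exprn_gt0 //.
rewrite ler_pdivlMr ?exprn_gt0 // mul1r -!natrX ler_nat.
case: (k) => [//|m]; apply: (@leq_trans (m.+1.*2.+1 ^ m.+1)%N).
  by rewrite leq_exp2r // doubleS.
by rewrite leq_pexp2l.
Qed.

(** * Polynomials in biased bits and hypercontractivity *)

Section Bits.
Variables (R : realType) (p : R).
Hypothesis hp : 0 < p < 1.

(** The normalized variable as a function of its underlying bit. *)
Definition chi (b : bool) : R :=
  if b then Num.sqrt ((1 - p) / p) else - Num.sqrt (p / (1 - p)).

(** Expectation over n independent bits, which are true with probability p.  The
recursion on n turns tensorization into induction; reading a sequence with a
default value spares the dependency of its length on n. *)
Fixpoint bexp (n : nat) (f : seq bool -> R) : R :=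
  if n is n'.+1 then p * bexp n' (fun s => f (true :: s)) +
                     (1 - p) * bexp n' (fun s => f (false :: s))
  else f [::].

Let p0 : 0 < p. Proof. by case/andP: hp. Qed.
Let q0 : 0 < 1 - p. Proof. by rewrite subr_gt0; case/andP: hp. Qed.

Lemma eq_bexp n f g : (forall s, size s = n -> f s = g s) -> bexp n f = bexp n g.
Proof.
elim: n f g => [|n IH] f g fg /=; first exact: fg.
by congr (_ * _ + _ * _); apply: IH => s sn; rewrite fg //= sn.
Qed.

Lemma bexp_cst n c : bexp n (fun=> c) = c.
Proof. by elim: n => //= n ->; rewrite -mulrDl subrKC mul1r. Qed.

Lemma bexpD n f g : bexp n (fun s => f s + g s) = bexp n f + bexp n g.
Proof. by elim: n f g => //= n IH f g; rewrite !IH; ring. Qed.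

Lemma bexpZ n c f : bexp n (fun s => c * f s) = c * bexp n f.
Proof. by elim: n f => //= n IH f; rewrite !IH; ring. Qed.

Lemma bexp_sum (I : Type) (r : seq I) (Q : pred I) n (F : I -> seq bool -> R) :
  bexp n (fun s => \sum_(i <- r | Q i) F i s) = \sum_(i <- r | Q i) bexp n (F i).
Proof.
elim: r => [|i r IH].
  rewrite big_nil -[RHS](bexp_cst n).
  by apply: eq_bexp => s _; rewrite big_nil.
rewrite big_cons -IH.
rewrite (eq_bexp (g := fun s => (if Q i then F i s else 0) + \sum_(i <- r | Q i) F i s)).
  by rewrite bexpD; case: (Q i) => //; rewrite bexp_cst add0r.
by move=> s _; rewrite big_cons; case: (Q i) => //; rewrite add0r.
Qed.

Lemma bexp_le n f g : (forall s, size s = n -> f s <= g s) -> bexp n f <= bexp n g.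
Proof.
elim: n f g => [|n IH] f g fg /=; first exact: fg.
by apply: lerD; rewrite ler_pM2l //; apply: IH => s sn; rewrite fg //= sn.
Qed.

Lemma bexp_ge0 n f : (forall s, 0 <= f s) -> 0 <= bexp n f.
Proof. by move=> f0; rewrite -(bexp_cst n 0); apply: bexp_le. Qed.

Lemma bexp_eq0 n f : (forall s, 0 <= f s) -> bexp n f = 0 ->
  forall s, size s = n -> f s = 0.
Proof.
elim: n f => [|n IH] f f0 /= E s; first by move/size0nil->.
case: s => // b s [sn].
have t0 : 0 <= p * bexp n (fun s => f (true :: s)).
  by rewrite mulr_ge0 ?(ltW p0) ?(ltW q0) ?bexp_ge0.
have u0 : 0 <= (1 - p) * bexp n (fun s => f (false :: s)).
  by rewrite mulr_ge0 ?(ltW p0) ?(ltW q0) ?bexp_ge0.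
move/eqP: E; rewrite paddr_eq0 // !mulf_eq0 (gt_eqF p0) (gt_eqF q0) /= => /andP[/eqP ? /eqP ?].
by case: b; [apply: (IH (fun s => f (true :: s)))|apply: (IH (fun s => f (false :: s)))].
Qed.

Lemma ler_norm_bexp n f : `|bexp n f| <= bexp n (fun s => `|f s|).
Proof.
elim: n f => //= n IH f; apply: le_trans (ler_normD _ _) _.
by rewrite !normrM (gtr0_norm p0) (gtr0_norm q0) lerD // ler_pM2l.
Qed.

Lemma bexp_CS n f g :
  bexp n (fun s => f s * g s) ^+ 2 <= bexp n (fun s => f s ^+ 2) * bexp n (fun s => g s ^+ 2).
Proof.
set c := bexp n (fun s => f s * g s); set a := bexp n _; set b := bexp n _.
have h x : 0 <= a - 2 * x * c + x ^+ 2 * b.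
  have -> : a - 2 * x * c + x ^+ 2 * b = bexp n (fun s => (f s - x * g s) ^+ 2).
    rewrite /a /b /c -bexpZ -[- _]mulN1r -!bexpZ -!bexpD.
    by apply: eq_bexp => s _; ring.
  by apply: bexp_ge0 => s; exact: sqr_ge0.
have b0 : 0 <= b by apply: bexp_ge0 => s; exact: sqr_ge0.
have [b00|bn0] := eqVneq b 0.
  have -> : c = 0.
    rewrite /c -(bexp_cst n 0); apply: eq_bexp => s sn.
    have /eqP := bexp_eq0 (fun s => sqr_ge0 (g s)) b00 sn.
    by rewrite sqrf_eq0 => /eqP ->; rewrite mulr0.
  by rewrite b00 mulr0 expr0n.
have {}b0 : 0 < b by rewrite lt0r bn0.
have := h (c / b); rewrite -(pmulr_rge0 _ b0).
have -> : b * (a - 2 * (c / b) * c + (c / b) ^+ 2 * b) = a * b - c ^+ 2 by field.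
by rewrite subr_ge0.
Qed.

Lemma convex_pow m (th x y : R) : 0 <= th <= 1 -> 0 <= x -> 0 <= y ->
  (th * x + (1 - th) * y) ^+ m <= th * x ^+ m + (1 - th) * y ^+ m.
Proof.
move=> /andP[t0 t1] x0 y0; elim: m => [|m IH]; first by rewrite !expr0; lra.
have w0 : 0 <= th * x + (1 - th) * y by rewrite addr_ge0 // mulr_ge0 // subr_ge0.
rewrite exprS; apply: le_trans (ler_wpM2l w0 IH) _; rewrite -subr_ge0.
have -> : th * x ^+ m.+1 + (1 - th) * y ^+ m.+1 -
  (th * x + (1 - th) * y) * (th * x ^+ m + (1 - th) * y ^+ m) =
  th * (1 - th) * ((x - y) * (x ^+ m - y ^+ m)) by rewrite !exprS; ring.
apply: mulr_ge0; first by rewrite mulr_ge0 // subr_ge0.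
have [xy|/ltW yx] := leP x y.
  by apply: mulr_le0; rewrite subr_le0 // lerXn2r.
by apply: mulr_ge0; rewrite subr_ge0 // lerXn2r.
Qed.

(** Minkowski's inequality, in a form free of roots.  By convexity of the power, the
integrand divided by (U+V)^(m+1) is at most the average of (u/U)^(m+1) and (v/V)^(m+1) with weights
proportional to U and V. *)
Lemma bexp_minkowski n m (u v : seq bool -> R) (U V : R) :
  (forall s, 0 <= u s) -> (forall s, 0 <= v s) -> 0 <= U -> 0 <= V ->
  bexp n (fun s => u s ^+ m.+1) <= U ^+ m.+1 ->
  bexp n (fun s => v s ^+ m.+1) <= V ^+ m.+1 ->
  bexp n (fun s => (u s + v s) ^+ m.+1) <= (U + V) ^+ m.+1.
Proof.
move=> u0 v0 U0 V0 hu hv.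
have zero (f g : seq bool -> R) : (forall s, 0 <= f s) ->
    bexp n (fun s => f s ^+ m.+1) <= 0 ->
    bexp n (fun s => (f s + g s) ^+ m.+1) = bexp n (fun s => g s ^+ m.+1).
  move=> f0 hf; apply: eq_bexp => s sn.
  have f0' t : 0 <= f t ^+ m.+1 by exact: exprn_ge0.
  have /(bexp_eq0 f0')/(_ s sn)/eqP : bexp n (fun s => f s ^+ m.+1) = 0.
    by apply/eqP; rewrite eq_le hf bexp_ge0.
  by rewrite expf_eq0 => /andP[_ /eqP ->]; rewrite add0r.
have [U00|Un0] := eqVneq U 0.
  by rewrite zero // ?U00 ?add0r //; apply: le_trans hu _; rewrite U00 expr0n.
have [V00|Vn0] := eqVneq V 0.
  rewrite (eq_bexp (g := fun s => (v s + u s) ^+ m.+1)) => [|s _]; last by rewrite addrC.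
  by rewrite zero // ?V00 ?addr0 //; apply: le_trans hv _; rewrite V00 expr0n.
have {}U0 : 0 < U by rewrite lt0r Un0.
have {}V0 : 0 < V by rewrite lt0r Vn0.
set th := U / (U + V).
have UV0 : 0 < U + V by exact: addr_gt0.
have th01 : 0 <= th <= 1.
  by rewrite /th divr_ge0 ?(ltW U0) ?(ltW UV0) //= ler_pdivrMr // mul1r lerDl ltW.
apply: le_trans (_ : bexp n (fun s => (U + V) ^+ m.+1 *
    (th / U ^+ m.+1 * u s ^+ m.+1 + (1 - th) / V ^+ m.+1 * v s ^+ m.+1)) <= _).
  apply: bexp_le => s _.
  have -> : u s + v s = (U + V) * (th * (u s / U) + (1 - th) * (v s / V)).
    by rewrite /th; field; rewrite !gt_eqF.
  rewrite exprMn ler_pM2l ?exprn_gt0 //.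
  apply: le_trans (convex_pow _ th01 _ _) _; rewrite ?divr_ge0 ?(ltW U0) ?(ltW V0) //.
  by rewrite !expr_div_n le_eqVlt; apply/orP; left; apply/eqP; ring.
rewrite bexpZ bexpD !bexpZ -[leRHS]mulr1 ler_pM2l ?exprn_gt0 //.
have E : th / U ^+ m.+1 * U ^+ m.+1 + (1 - th) / V ^+ m.+1 * V ^+ m.+1 = 1.
  by rewrite !divfK ?expf_neq0 // subrKC.
rewrite -[leRHS]E.
case/andP: th01 => t0 t1.
by apply: lerD; apply: ler_wpM2l => //; rewrite divr_ge0 ?exprn_ge0 ?subr_ge0 ?(ltW U0) ?(ltW V0).
Qed.

(** Degree at most D in the first n bits, by separating the first bit: the part
that multiplies chi b has one degree less, hence vanishes if D = 0. *)
Fixpoint pdeg (n D : nat) (f : seq bool -> R) : Prop :=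
  if n is n'.+1 then
    exists A B : seq bool -> R,
      [/\ forall b s, f (b :: s) = A s + chi b * B s, pdeg n' D A
        & if D is D'.+1 then pdeg n' D' B else forall s, B s = 0]
  else True.

(** Degree strictly less than D. *)
Definition pdegp n D B := if D is D'.+1 then pdeg n D' B else forall s, B s = 0.

Lemma pdeg_cst n D c : pdeg n D (fun=> c).
Proof.
elim: n D c => //= n IH D c; exists (fun=> c), (fun=> 0).
by split=> // [b s|]; [rewrite mulr0 addr0|case: D].
Qed.

Lemma eq_pdeg n D f g : f =1 g -> pdeg n D f -> pdeg n D g.
Proof. by move=> /funext ->. Qed.

Lemma pdegp0 n D f : (forall s, f s = 0) -> pdegp n D f.
Proof.
by move=> f0; case: D => //= D; apply: (eq_pdeg (f := fun=> 0)) => //; exact: pdeg_cst.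
Qed.

Lemma pdegS n D f : pdeg n D f -> pdeg n D.+1 f.
Proof.
elim: n D f => //= n IH D f [A [B [fE dA dB]]]; exists A, B; split=> //; first exact: IH.
by case: D dB {dA} => [|D]; [exact: (@pdegp0 n 1 B)|exact: IH].
Qed.

Lemma pdegp_pdeg n D f : pdegp n D f -> pdeg n D f.
Proof. by case: D => [|D]; [exact: (@pdegp0 n 1 f)|exact: pdegS]. Qed.

Lemma pdeg_le n D D' f : (D <= D')%N -> pdeg n D f -> pdeg n D' f.
Proof.
by move=> /subnK <- df; elim: (D' - D)%N => // k IH; rewrite addSn; exact: pdegS.
Qed.

Lemma pdegD n D f g : pdeg n D f -> pdeg n D g -> pdeg n D (fun s => f s + g s).
Proof.
elim: n D f g => //= n IH D f g [A [B [fE dA dB]]] [A' [B' [gE dA' dB']]].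
exists (fun s => A s + A' s), (fun s => B s + B' s); split.
- by move=> b s; rewrite fE gE; ring.
- exact: IH.
- case: D dB dB' {dA dA'} => [h h' s|D]; last exact: IH.
  by rewrite h h' addr0.
Qed.

Lemma pdegpD n D f g : pdegp n D f -> pdegp n D g -> pdegp n D (fun s => f s + g s).
Proof. by case: D => [h h' s|D]; [rewrite h h' addr0|exact: pdegD]. Qed.

(** Squares of variables reduce to affine functions, so that products of multilinear
polynomials are multilinear; this is what makes pdegM hold. *)
Lemma chi_sqr b : chi b ^+ 2 = 1 + (chi true + chi false) * chi b.
Proof.
have E := sqrtpq_x12 hp; have s0 : Num.sqrt (p * (1 - p)) != 0.
  by apply/eqP => s0; move/eqP: E; rewrite s0 mul0r eq_sym oner_eq0.
have a1 := px1 hp; have a2 := qx2 hp.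
have c12 : chi true * chi false = -1.
  have pq : p * (1 - p) != 0 by rewrite mulf_neq0 ?gt_eqF.
  apply: (mulfI pq); rewrite mulrACA [p * chi true]a1 [(1 - p) * chi false]a2 mulrN -expr2.
  by rewrite sqr_sqrtr ?mulrN1 // mulr_ge0 ?ltW.
by case: b; rewrite -[1]opprK -c12; ring.
Qed.

Lemma pdegM n D D' f g : pdeg n D f -> pdeg n D' g ->
  pdeg n (D + D') (fun s => f s * g s).
Proof.
elim: n D D' f g => //= n IH D D' f g [A [B [fE dA dB]]] [A' [B' [gE dA' dB']]].
have MP E E' u v : pdeg n E u -> pdegp n E' v -> pdegp n (E + E') (fun s => u s * v s).
  case: E' => [|E'] du dv; last by rewrite addnS; exact: IH.
  by apply: pdegp0 => s; rewrite dv mulr0.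
have PP E E' u v : pdegp n E u -> pdegp n E' v -> pdegp n (E + E') (fun s => u s * v s).
  by move=> /pdegp_pdeg; exact: MP.
have dBB := PP _ _ _ _ dB dB'.
exists (fun s => A s * A' s + B s * B' s).
exists (fun s => (A s * B' s + A' s * B s) + (chi true + chi false) * (B s * B' s)); split.
- move=> b s; rewrite fE gE.
  transitivity (A s * A' s + chi b * (A s * B' s + A' s * B s) + chi b ^+ 2 * (B s * B' s)).
    by ring.
  by rewrite chi_sqr; ring.
- by apply: pdegD; [exact: IH|exact: pdegp_pdeg].
- apply: (@pdegpD n (D + D')); first apply: pdegpD; first exact: MP.
    by rewrite addnC; exact: MP.
  by apply: (MP 0%N (D + D')%N (fun=> chi true + chi false)); first exact: pdeg_cst.
Qed.

Lemma pdegX n D f j : pdeg n D f -> pdeg n (D * j) (fun s => f s ^+ j).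
Proof.
move=> df; elim: j => [|j IH]; first by rewrite muln0; exact: pdeg_cst.
rewrite mulnS; apply: (eq_pdeg (f := fun s => f s * f s ^+ j)) => [s|]; first by rewrite exprS.
exact: pdegM.
Qed.

Lemma pdeg_sum n D (I : Type) (r : seq I) (Q : pred I) (F : I -> seq bool -> R) :
  (forall i, Q i -> pdeg n D (F i)) -> pdeg n D (fun s => \sum_(i <- r | Q i) F i s).
Proof.
move=> h; elim: r => [|i r IH].
  by apply: (eq_pdeg (f := fun=> 0)) => [s|]; [rewrite big_nil|exact: pdeg_cst].
apply: (eq_pdeg (f := fun s => (if Q i then F i s else 0) + \sum_(i <- r | Q i) F i s)).
  by move=> s; rewrite big_cons; case: (Q i); rewrite ?add0r.
by apply: pdegD => //; case Qi: (Q i); [exact: h|exact: pdeg_cst].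
Qed.

Definition monomial n (m : 'I_n -> bool) (s : seq bool) : R :=
  \prod_(i < n) (if m i then chi (nth false s i) else 1).

Lemma pdeg_monomial n (m : 'I_n -> bool) : pdeg n (\sum_i m i) (monomial m).
Proof.
elim: n m => //= n IH m.
rewrite big_ord_recl.
have E b s : monomial m (b :: s) = (if m ord0 then chi b else 1) * monomial (fun i => m (lift ord0 i)) s.
  by rewrite /monomial big_ord_recl.
have {}IH := IH (fun i => m (lift ord0 i)).
case: (m ord0) E => E.
  exists (fun=> 0), (monomial (fun i => m (lift ord0 i))); split=> //.
    by move=> b s; rewrite E add0r.
  exact: pdeg_cst.
exists (monomial (fun i => m (lift ord0 i))), (fun=> 0); split=> //.
  by move=> b s; rewrite E mul1r mulr0 addr0.
exact: (@pdegp0 n).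
Qed.

(** Parseval's identity for one bit: 1 and chi are orthonormal. *)
Lemma bexp_split_sqr n (A B : seq bool -> R) f :
  (forall b s, f (b :: s) = A s + chi b * B s) ->
  bexp n.+1 (fun s => f s ^+ 2) = bexp n (fun s => A s ^+ 2) + bexp n (fun s => B s ^+ 2).
Proof.
move=> fE /=; rewrite -!bexpZ -!bexpD; apply: eq_bexp => s _; rewrite !fE.
have a1 := px1 hp; have a2 := qx2 hp.
have b1 := x1_sqr hp; have b2 := x2_sqr hp.
have -> : p * (A s + chi true * B s) ^+ 2 + (1 - p) * (A s + chi false * B s) ^+ 2 =
  (p + (1 - p)) * A s ^+ 2 + 2 * (p * chi true + (1 - p) * chi false) * A s * B s
  + (p * chi true ^+ 2 + (1 - p) * chi false ^+ 2) * B s ^+ 2 by ring.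
rewrite [p * chi true]a1 [_ * chi false]a2 [chi true ^+ 2]b1 [chi false ^+ 2]b2.
by field; rewrite !gt_eqF.
Qed.

(** Writing f = A + chi B in the first bit, the two-point inequality bounds the
conditional moment by (A^2 + K B^2)^(k+1), and Minkowski's inequality in
L^(k+1) passes the sum through the remaining expectation.  Since B has one degree
less, its factor K is accounted for. *)
Lemma hypercontractive (tau : R) k n D f : 0 < tau ->
  tau ^+ k.+1 = 2 * Num.min p (1 - p) -> pdeg n D f ->
  bexp n (fun s => f s ^+ k.+1.*2) <=
  (hyper_const p tau k ^+ D * bexp n (fun s => f s ^+ 2)) ^+ k.+1.
Proof.
move=> tau0 tauE.
set K := hyper_const p tau k.
have K0 : 0 <= K.
  by rewrite /K /hyper_const mulr_ge0 // divr_ge0 ?ltW // mulr_gt0 // lam_gt0.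
elim: n D f => [|n IH] D f.
  have pw x m : x ^+ m.*2 = (x ^+ 2) ^+ m :> R by rewrite -exprM mulnC muln2.
  move=> _; change (f [::] ^+ k.+1.*2 <= (K ^+ D * f [::] ^+ 2) ^+ k.+1).
  rewrite pw [(K ^+ D * _) ^+ _]exprMn; case: D => [|D]; first by rewrite expr0 expr1n mul1r.
  (* Without variables f is constant but D is arbitrary, hence K >= 1 is needed. *)
  apply: ler_peMl; first by rewrite exprn_ge0 // sqr_ge0.
  apply: exprn_ege1; apply: exprn_ege1.
  have l0 := lam_gt0 hp; have l2 := lam_le p.
  have t1 : tau <= 1.
    rewrite leNgt; apply/negP => t1; have : 1 < tau ^+ k.+1 by rewrite exprn_egt1.
    by rewrite tauE; lra.
  have tl : 2 * Num.min p (1 - p) <= tau.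
    by rewrite -tauE exprS ler_piMr ?exprn_ile1 ?(ltW tau0).
  rewrite /K /hyper_const -[leLHS]mulr1; apply: ler_pM => //; first by rewrite ler1n.
  by rewrite ler_pdivlMr ?mul1r // mulr_gt0.
move=> [A [B [fE dA dB]]]; rewrite (bexp_split_sqr n fE) mulrDr.
have pw x m : x ^+ m.*2 = (x ^+ 2) ^+ m :> R by rewrite -exprM mulnC muln2.
apply: le_trans (_ : bexp n (fun s => (A s ^+ 2 + K * B s ^+ 2) ^+ k.+1) <= _).
  rewrite /= -!bexpZ -bexpD; apply: bexp_le => s _; rewrite !fE ![chi _ * _]mulrC.
  exact: two_point.
have sq g : 0 <= bexp n (fun s => g s ^+ 2) by apply: bexp_ge0 => s; exact: sqr_ge0.
have KD0 : 0 <= K ^+ D by rewrite exprn_ge0.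
apply: bexp_minkowski => [s|s||||].
- exact: sqr_ge0.
- by rewrite mulr_ge0 ?sqr_ge0.
- by rewrite mulr_ge0.
- by rewrite mulr_ge0.
- apply: le_trans (IH D A dA).
  by rewrite (eq_bexp (g := fun s => A s ^+ k.+1.*2)) // => s _; rewrite pw.
case: D dB {dA KD0} => [B0|D dB].
  rewrite (eq_bexp (g := fun=> 0)) => [|s _]; last by rewrite B0 expr0n mulr0 expr0n.
  by rewrite bexp_cst exprn_ge0 // mulr_ge0 ?exprn_ge0.
rewrite (eq_bexp (g := fun s => K ^+ k.+1 * B s ^+ k.+1.*2)) => [|s _]; last by rewrite pw exprMn.
by rewrite bexpZ [K ^+ D.+1]exprS -mulrA [(K * _) ^+ k.+1]exprMn ler_wpM2l ?exprn_ge0 // IH.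
Qed.
End Bits.
Arguments eq_bexp {R p n f g}.

(** * Low-degree polynomials against waves *)

Section Waves.
Variable R : realType.

Lemma polar_form (x y : R) :
  exists r w : R, [/\ 0 <= r, x = r * cos w & y = r * sin w].
Proof.
set r := Num.sqrt (x ^+ 2 + y ^+ 2).
have r0 : 0 <= r by exact: sqrtr_ge0.
have r2 : r ^+ 2 = x ^+ 2 + y ^+ 2 by rewrite sqr_sqrtr // addr_ge0 // sqr_ge0.
have [rz|rn] := eqVneq r 0.
  move: r2; rewrite rz expr0n => /esym/eqP.
  rewrite paddr_eq0 ?sqr_ge0 // !sqrf_eq0 => /andP[/eqP -> /eqP ->].
  by exists 0, 0; rewrite !mul0r.
have rp : 0 < r by rewrite lt0r rn.
have h : (x / r) ^+ 2 + (y / r) ^+ 2 = 1.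
  by rewrite !expr_div_n -mulrDl -r2 divff // sqrf_eq0.
have x1 : -1 <= x / r <= 1.
  rewrite -ler_norml -(expr_le1 (n := 2)) // real_normK ?num_real // -h lerDl.
  exact: sqr_ge0.
have c : cos (acos (x / r)) = x / r by apply: acosK; rewrite in_itv.
have s : sin (acos (x / r)) = `|y / r|.
  by rewrite sin_acos // -sqrtr_sqr; congr Num.sqrt; lra.
have [y0|y0] := leP 0 (y / r).
  by exists r, (acos (x / r)); split; rewrite ?c ?s ?(ger0_norm y0) // mulrC divfK.
exists r, (- acos (x / r)); split; rewrite ?cosN ?sinN ?c ?s ?(ltr0_norm y0) ?opprK //.
  by rewrite mulrC divfK.
by rewrite mulrC divfK.
Qed.

(** Two waves of the same frequency add up to a wave, with the amplitude of the sum
of the two complex numbers. *)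
Lemma wave_sum (u v al be : R) : exists r w : R,
  [/\ 0 <= r, r ^+ 2 = u ^+ 2 + v ^+ 2 + 2 * u * v * cos (al - be)
    & forall c, u * cos (c + al) + v * cos (c + be) = r * cos (c + w)].
Proof.
have [r [w [r0 xE yE]]] :=
  polar_form (u * cos al + v * cos be) (u * sin al + v * sin be).
exists r, w; split => // [|c].
  have := cos2Dsin2 al; have := cos2Dsin2 be; have := cos2Dsin2 w.
  rewrite cosB => hw hb ha.
  have -> : r ^+ 2 = (r * cos w) ^+ 2 + (r * sin w) ^+ 2.
    by rewrite !exprMn -mulrDr hw mulr1.
  rewrite -xE -yE.
  transitivity (u ^+ 2 * (cos al ^+ 2 + sin al ^+ 2) + v ^+ 2 * (cos be ^+ 2 + sin be ^+ 2)
     + 2 * u * v * (cos al * cos be + sin al * sin be)); first by ring.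
  by rewrite ha hb !mulr1.
rewrite !cosD.
transitivity (cos c * (u * cos al + v * cos be) - sin c * (u * sin al + v * sin be)).
  by ring.
by rewrite xE yE; ring.
Qed.
End Waves.

Section Levels.
Variables (R : realType) (p : R).
Hypothesis hp : 0 < p < 1.
Local Notation chi := (chi p).
Local Notation bexp := (bexp p).
Local Notation pdeg := (pdeg p).

Let p0 : 0 < p. Proof. by case/andP: hp. Qed.
Let q0 : 0 < 1 - p. Proof. by rewrite subr_gt0; case/andP: hp. Qed.

(** This is 1 - |E exp(isX)|^2 for one variable X, the mass lost by level 0 of
exp(isX); by Parseval's identity it equals |E X exp(isX)|^2. *)
Definition loss (s : R) : R :=
  4 * (p * (1 - p)) * sin (s / (2 * Num.sqrt (p * (1 - p)))) ^+ 2.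

Let spq0 : 0 < Num.sqrt (p * (1 - p)).
Proof. by rewrite sqrtr_gt0 mulr_gt0. Qed.

Let cos_gap (s : R) : cos (s * chi true - s * chi false) =
  1 - 2 * sin (s / (2 * Num.sqrt (p * (1 - p)))) ^+ 2.
Proof.
have E := sqrtpq_x12 hp.
have -> : s * chi true - s * chi false = (s / (2 * Num.sqrt (p * (1 - p)))) *+ 2.
  rewrite -mulrBr -[_ *+ 2]mulr_natr.
  have -> : chi true - chi false = (Num.sqrt (p * (1 - p)))^-1.
    by apply: (mulfI (lt0r_neq0 spq0)); rewrite [LHS]E divff ?lt0r_neq0.
  by field; rewrite gt_eqF.
set x := _ / _; rewrite cos_mulr2n; have := cos2Dsin2 x => h.
by rewrite mulr2n; lra.
Qed.

Lemma wave_mean (s : R) : exists r w : R, [/\ 0 <= r, r ^+ 2 = 1 - loss s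
  & forall c, p * cos (c + s * chi true) + (1 - p) * cos (c + s * chi false) =
     r * cos (c + w)].
Proof.
have [r [w [r0 r2 h]]] := wave_sum p (1 - p) (s * chi true) (s * chi false).
by exists r, w; split => //; rewrite r2 cos_gap /loss; ring.
Qed.

Lemma wave_slope (s : R) : exists r w : R, [/\ 0 <= r, r ^+ 2 = loss s
  & forall c, p * (chi true * cos (c + s * chi true)) +
     (1 - p) * (chi false * cos (c + s * chi false)) = r * cos (c + w)].
Proof.
set v := Num.sqrt (p * (1 - p)).
have [r [w [r0 r2 h]]] := wave_sum v (- v) (s * chi true) (s * chi false).
exists r, w; split => // [|c].
  rewrite r2 cos_gap sqrrN mulrN.
  have -> : v ^+ 2 = p * (1 - p) by rewrite sqr_sqrtr // mulr_ge0 // ltW.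
  have -> : 2 * v * v = 2 * (p * (1 - p)).
    by rewrite -mulrA -expr2 sqr_sqrtr // mulr_ge0 // ltW.
  by rewrite /loss; ring.
by rewrite -h !mulrA [p * _](px1 hp) [(1 - p) * _](qx2 hp).
Qed.

Lemma loss_ge0 s : 0 <= loss s.
Proof. by have [r [w [_ <- _]]] := wave_slope s; exact: sqr_ge0. Qed.

Lemma loss_le1 s : loss s <= 1.
Proof. by have [r [w [_ h _]]] := wave_mean s; rewrite -subr_ge0 -h sqr_ge0. Qed.

Definition lin_form n (a : 'I_n -> R) (s : seq bool) : R :=
  \sum_(i < n) a i * chi (nth false s i).

Let linS n (a : 'I_n.+1 -> R) b s :
  lin_form a (b :: s) = a ord0 * chi b + lin_form (fun i => a (lift ord0 i)) s.
Proof. by rewrite /lin_form big_ord_recl. Qed.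

(** In Fourier terms, let W_k be the mass of exp(i sum a_i X_i) on level k.
Cauchy-Schwarz bounds the squared pairing with f by E f^2 times
W_0 + ... + W_D, which is at most z^(-D) times the sum of all z^k W_k, and that
sum factors over the variables as the product of (1 - loss) + z loss.  The
induction on the variables does both steps at once, the phase th standing for
the argument of the complex number. *)
Lemma lowdeg_wave n D f (a : 'I_n -> R) (th z : R) : 0 < z <= 1 -> pdeg n D f ->
  bexp n (fun s => cos (th + lin_form a s) * f s) ^+ 2 * z ^+ D <=
  (\prod_i (1 - (1 - z) * loss (a i))) * bexp n (fun s => f s ^+ 2).
Proof.
move=> /andP[z0 z1]; elim: n D f a th => [|n IH] D f a th.
  move=> _ /=; rewrite big_ord0 mul1r.
  apply: le_trans (_ : (cos (th + lin_form a [::]) * f [::]) ^+ 2 <= _).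
    by rewrite ler_piMr ?sqr_ge0 // exprn_ile1 // ltW.
  rewrite exprMn ler_piMl ?sqr_ge0 //.
move=> [A [B [fE dA dB]]]; rewrite (bexp_split_sqr hp n fE) big_ord_recl.
set a' := fun i => a (lift ord0 i); set P := \prod_i _.
have P0 : 0 <= P.
  apply: prodr_ge0 => i _; have l0 := loss_ge0 (a (lift ord0 i)).
  have l1 := loss_le1 (a (lift ord0 i)); nra.
have [r0 [w0 [r00 r02 h0]]] := wave_mean (a ord0).
have [r1 [w1 [r10 r12 h1]]] := wave_slope (a ord0).
set g := loss (a ord0) in r02 r12 *.
have g0 : 0 <= g by exact: loss_ge0.
set al := bexp n (fun s => cos (th + w0 + lin_form a' s) * A s).
set be := bexp n (fun s => cos (th + w1 + lin_form a' s) * B s).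
have -> : bexp n.+1 (fun s => cos (th + lin_form a s) * f s) = r0 * al + r1 * be.
  rewrite /= /al /be -!bexpZ -!bexpD; apply: eq_bexp => s _.
  rewrite !fE !linS -/a'.
  have e0 := h0 (th + lin_form a' s); have e1 := h1 (th + lin_form a' s).
  have E w : th + (w + lin_form a' s) = th + lin_form a' s + w by ring.
  have -> : th + w0 + lin_form a' s = th + lin_form a' s + w0 by ring.
  have -> : th + w1 + lin_form a' s = th + lin_form a' s + w1 by ring.
  rewrite !E ?[r0 * (_ * _)]mulrA ?[r1 * (_ * _)]mulrA -e0 -e1; ring.
set EA := bexp n (fun s => A s ^+ 2); set EB := bexp n (fun s => B s ^+ 2).
have IA : al ^+ 2 * z ^+ D <= P * EA := IH D A a' (th + w0) dA.
have IB : be ^+ 2 * z ^+ D <= z * (P * EB).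
  case: D dB {dA IA} => [B0|D dB].
    rewrite /be (eq_bexp (g := fun=> 0)) => [|s _]; last by rewrite B0 mulr0.
    rewrite bexp_cst expr0n mul0r mulr_ge0 ?(ltW z0) // mulr_ge0 //.
    by apply: (bexp_ge0 hp) => s; exact: sqr_ge0.
  by rewrite [z ^+ _]exprS mulrCA ler_pM2l // IH.
(* Cauchy-Schwarz for the weights 1 and z of the two levels. *)
have cs : z * (r0 * al + r1 * be) ^+ 2 <= (r0 ^+ 2 + z * r1 ^+ 2) * (z * al ^+ 2 + be ^+ 2).
  rewrite -subr_ge0.
  have -> : (r0 ^+ 2 + z * r1 ^+ 2) * (z * al ^+ 2 + be ^+ 2) - z * (r0 * al + r1 * be) ^+ 2
    = (r0 * be - z * r1 * al) ^+ 2 by ring.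
  exact: sqr_ge0.
have zD : 0 <= z ^+ D by rewrite exprn_ge0 // ltW.
rewrite r02 r12 in cs.
have k0 : 0 <= 1 - g + z * g by have := loss_le1 (a ord0); rewrite -/g; nra.
rewrite -(ler_pM2l z0) mulrA.
apply: le_trans (ler_wpM2r zD cs) _.
have -> : 1 - (1 - z) * g = 1 - g + z * g by ring.
rewrite -[leLHS]mulrA [leRHS](_ : _ = (1 - g + z * g) * (z * (P * EA) + z * (P * EB))); last by ring.
apply: ler_wpM2l => //; rewrite mulrDl -mulrA.
by apply: lerD => //; rewrite ler_pM2l.
Qed.

(** Independence factors the expectation.  A variable in the monomial contributes
E[X exp(isX)], bounded by 1; the others contribute |E exp(isX)|. *)
Lemma monomial_wave n (m : 'I_n -> bool) (a : 'I_n -> R) (th : R) :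
  `|bexp n (fun s => cos (th + lin_form a s) * monomial p m s)| <=
  \prod_(i | ~~ m i) Num.sqrt (1 - loss (a i)).
Proof.
elim: n m a th => [|n IH] m a th.
  by rewrite /= /monomial !big_ord0 mulr1 (cos_max (th + _)).
set a' := fun i => a (lift ord0 i); set m' := fun i => m (lift ord0 i).
have monS b s : monomial p m (b :: s) = (if m ord0 then chi b else 1) * monomial p m' s.
  by rewrite /monomial big_ord_recl.
rewrite big_mkcond big_ord_recl -big_mkcond.
have {}IH th' := IH m' a' th'.
have step (e : bool -> R) r w : 0 <= r -> (forall b s, monomial p m (b :: s) = e b * monomial p m' s) ->
    (forall c, p * (e true * cos (c + a ord0 * chi true)) +
       (1 - p) * (e false * cos (c + a ord0 * chi false)) = r * cos (c + w)) ->
    bexp n.+1 (fun s => cos (th + lin_form a s) * monomial p m s) =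
    r * bexp n (fun s => cos (th + w + lin_form a' s) * monomial p m' s).
  move=> r0 eE h; rewrite /= -!bexpZ -bexpD; apply: eq_bexp => s _.
  rewrite !eE !linS -/a'.
  have e0 := h (th + lin_form a' s).
  have E w' : th + (w' + lin_form a' s) = th + lin_form a' s + w' by ring.
  have -> : th + w + lin_form a' s = th + lin_form a' s + w by ring.
  by rewrite !E // [r * (_ * _)]mulrA -e0; ring.
set bx := bexp n.+1 _ in step *; case: (m ord0) monS => monS /=.
  have [r [w [r0 r2 h]]] := wave_slope (a ord0).
  rewrite (step _ _ _ r0 monS h) normrM (ger0_norm r0) mul1r -[leRHS]mul1r.
  apply: ler_pM => //.
  by rewrite -(expr_le1 (n := 2)) // r2 loss_le1.
have [r [w [r0 r2 h]]] := wave_mean (a ord0).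
rewrite (step (fun=> 1) r w r0 monS) => [|c]; last by rewrite !mul1r h.
rewrite normrM -r2 sqrtr_sqr; apply: ler_pM => //.
Qed.
End Levels.

(** * Decay of the characteristic function of one bit *)

Section Trig.
Variable R : realType.
Local Notation pi := (@pi R).

Lemma sin_chord (y b : R) : 0 <= y <= b -> b <= pi -> y * sin b <= b * sin y.
Proof.
move=> /andP[y0 yb] bpi.
have csin : continuous (@sin R) by exact: continuous_sin.
have [c1 c1in E1] : exists2 c, c \in `[0, y]%R & sin y - sin 0 = cos c * (y - 0).
  by apply: MVT_segment => //; apply: continuous_subspaceT.
have [c2 c2in E2] : exists2 c, c \in `[y, b]%R & sin b - sin y = cos c * (b - y).
  by apply: MVT_segment => //; apply: continuous_subspaceT.
move: c1in c2in; rewrite !in_itv /= => /andP[c10 c1y] /andP[c2y c2b].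
have c12 : cos c2 <= cos c1.
  have [->//|ne] := eqVneq c1 c2.
  apply: ltW; rewrite ltr_cos ?in_itv /=; first by rewrite lt_neqAle ne; lra.
    by apply/andP; split; lra.
  by apply/andP; split; lra.
rewrite sin0 !subr0 in E1; rewrite -subr_ge0.
have -> : sin b = sin y + cos c2 * (b - y) by lra.
have -> : b * sin y - y * (sin y + cos c2 * (b - y)) = (b - y) * (y * (cos c1 - cos c2)).
  by rewrite E1; ring.
by rewrite mulr_ge0 ?subr_ge0 // mulr_ge0 ?subr_ge0.
Qed.

(** By the half-angle formula this is the chord bound for the concave function sin
on [0, pi/4], squared. *)
Lemma cos_le_parabola (x : R) : `|x| <= pi / 2 -> cos x <= 1 - 4 * x ^+ 2 / pi ^+ 2.
Proof.
rewrite -cos_norm -(real_normK (num_real x)); move: `|x| (normr_ge0 x) => {}x x0 xpi.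
have pi0 := pi_gt0 R.
have y0 : 0 <= x / 2 <= pi / 4 by apply/andP; split; lra.
have s4 : sin (pi / 4) ^+ 2 = 1 / 2.
  have := cos_pihalf R; have -> : pi / 2 = (pi / 4) *+ 2.
    by rewrite -[_ *+ 2]mulr_natr; field.
  by rewrite cos_mulr2n mulr2n; have := cos2Dsin2 (pi / 4); lra.
have s40 : 0 <= sin (pi / 4) by apply: sin_ge0_pi; apply/andP; split; lra.
have sy0 : 0 <= sin (x / 2) by apply: sin_ge0_pi; apply/andP; split; lra.
have ch := sin_chord y0 (_ : pi / 4 <= pi).
have {}ch : x / 2 * sin (pi / 4) <= pi / 4 * sin (x / 2) by apply: ch; lra.
have xh0 : 0 <= x / 2 by case/andP: y0.
have : (x / 2 * sin (pi / 4)) ^+ 2 <= (pi / 4 * sin (x / 2)) ^+ 2.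
  by rewrite lerXn2r // nnegrE mulr_ge0 //; lra.
have -> : (x / 2 * sin (pi / 4)) ^+ 2 = x ^+ 2 / 8.
  by rewrite [LHS]exprMn s4; field.
have -> : (pi / 4 * sin (x / 2)) ^+ 2 = pi ^+ 2 / 16 * sin (x / 2) ^+ 2 by field.
have -> : cos x = 1 - 2 * sin (x / 2) ^+ 2.
  have {1}-> : x = (x / 2) *+ 2 by rewrite -[_ *+ 2]mulr_natr; field.
  by rewrite cos_mulr2n mulr2n; have := cos2Dsin2 (x / 2); lra.
move=> h; rewrite lerD2l lerN2 ler_pdivrMr ?exprn_gt0 //.
set s := sin _ ^+ 2 in h *.
by lra.
Qed.

Lemma isd_sum (n : nat) (F : nat -> R -> R) (dF : nat -> R) (x : R) :
  (forall j, is_derive x 1 (F j) (dF j)) ->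
  is_derive x 1 (fun t => \sum_(j < n) F j t) (\sum_(j < n) dF j).
Proof.
move=> h; elim: n => [|n IH].
  rewrite big_ord0 (_ : (fun _ => _) = fun=> 0); first exact: isd_cst.
  by apply/funext => t; rewrite big_ord0.
rewrite big_ord_recr (_ : (fun _ => _) = fun t => \sum_(j < n) F j t + F n t).
  exact: isdD.
by apply/funext => t; rewrite big_ord_recr.
Qed.

(** The derivatives of cos are written as phase shifts, so that the derivative of
the remainder of order r+1 is the remainder of order r at a shifted phase. *)
Definition cos_rem (r : nat) (th y : R) : R :=
  cos (th + y) - \sum_(j < r) cos (th + j%:R * (pi / 2)) * (y ^+ j / j`!%:R).

Lemma is_derive_cos_rem r th (y : R) :
  is_derive y 1 (cos_rem r.+1 th) (cos_rem r (th + pi / 2) y).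
Proof.
have E t : cos_rem r.+1 th t = cos (th + t * 1) - (cos th + \sum_(j < r)
    cos (th + j.+1%:R * (pi / 2)) * (t ^+ j.+1 / (j.+1)`!%:R)).
  rewrite /cos_rem big_ord_recl mul0r addr0 expr0 fact0 divr1 !mulr1.
  by [].
rewrite (funext E).
have hc : is_derive y 1 (fun t => cos (th + t * 1)) (- sin (th + y * 1) * 1).
  by apply: (@is_derive1_comp R cos (fun t => th + t * 1)); exact: isd_aff.
have hj (j : nat) : is_derive y 1
   (fun t => cos (th + j.+1%:R * (pi / 2)) * (t ^+ j.+1 / (j.+1)`!%:R))
   (cos (th + pi / 2 + j%:R * (pi / 2)) * (y ^+ j / j`!%:R)).
  have h := isdZ (cos (th + j.+1%:R * (pi / 2)))
    (isdM (isdX j.+1 (isd_id y)) (isd_cst ((j.+1)`!%:R)^-1 y)).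
  apply: is_derive_eq h _; rewrite /= mulr1 mulr0 addr0 factS natrM.
  congr (cos _ * _); first by rewrite -natr1; ring.
  have f0 : j`!%:R != 0 :> R by rewrite pnatr_eq0 -lt0n fact_gt0.
  have j0 : j.+1%:R != 0 :> R by rewrite pnatr_eq0.
  by move: f0 j0; move: (j`!%:R) (j.+1%:R) => F J f0 j0; field; apply/andP.
have h := isdB hc (isdD (isd_cst (cos th) y) (isd_sum r hj)).
apply: is_derive_eq h _; rewrite /cos_rem add0r !mulr1 -cosDpihalf.
by congr (cos _ - _); ring.
Qed.

Lemma cos_taylor r th (y : R) : `|cos_rem r th y| <= `|y| ^+ r / r`!%:R.
Proof.
elim: r th y => [|r IH] th y.
  by rewrite /cos_rem big_ord0 subr0 expr0 fact0 divr1 cos_max.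
have z : cos_rem r.+1 th 0 = 0.
  rewrite /cos_rem big_ord_recl mul0r addr0 expr0 fact0 divr1 mulr1 big1 ?addr0 ?subrr //.
  by move=> i _; rewrite expr0n mul0r mulr0.
have dp (t : R) : is_derive t 1 (fun t => t ^+ r.+1 / (r.+1)`!%:R) (t ^+ r / r`!%:R).
  have h := isdM (isdX r.+1 (isd_id t)) (isd_cst ((r.+1)`!%:R)^-1 t).
  apply: is_derive_eq h _; rewrite /= mulr1 mulr0 addr0 factS natrM.
  have f0 : r`!%:R != 0 :> R by rewrite pnatr_eq0 -lt0n fact_gt0.
  have r0 : r.+1%:R != 0 :> R by rewrite pnatr_eq0.
  by move: f0 r0; move: (r`!%:R) (r.+1%:R) => F J f0 r0; field; apply/andP.
have dg t := is_derive_cos_rem r th t.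
have bnd t := IH (th + pi / 2) t.
have [y0|/ltW y0] := leP 0 y.
  rewrite (ger0_norm y0) ler_norml; apply/andP; split.
    have dS (t : R) := isdD (dp t) (dg t).
    have := ge0_derive_le y0 dS; rewrite z expr0n mul0r addr0 => h.
    rewrite -subr_ge0 opprK addrC; apply: h => t /andP[t0 _].
    by have := bnd t; rewrite (ger0_norm t0) ler_norml => /andP[? _]; lra.
  have dS (t : R) := isdB (dp t) (dg t).
  have := ge0_derive_le y0 dS; rewrite z expr0n mul0r subr0 => h.
  rewrite -subr_ge0; apply: h => t /andP[t0 _].
  by have := bnd t; rewrite (ger0_norm t0) ler_norml => /andP[_ ?]; lra.
have sg t m : t <= 0 -> `|t| ^+ m = (-1) ^+ m * t ^+ m :> R.
  by move=> t0; rewrite (ler0_norm t0) -exprMn mulN1r.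
have dq (t : R) := isdZ ((-1) ^+ r) (dp t).
rewrite ler_norml sg //.
have key (e : R) : (e = 1) \/ (e = -1) ->
    e * cos_rem r.+1 th y <= (-1) ^+ r.+1 * y ^+ r.+1 / (r.+1)`!%:R.
  move=> he; have dS (t : R) := isdD (dq t) (isdZ e (dg t)).
  have := ge0_derive_le y0 dS; rewrite z expr0n mul0r !mulr0 addr0 => h.
  rewrite exprS mulN1r -subr_ge0 -[leRHS]opprK oppr_ge0 opprB.
  suff : (-1) ^+ r * (y ^+ r.+1 / (r.+1)`!%:R) + e * cos_rem r.+1 th y <= 0 by lra.
  apply: h => t /andP[_ t0]; have := bnd t; rewrite sg // ler_norml -mulrA => /andP[? ?].
  by case: he => ->; lra.
apply/andP; split.
  have := key (-1) (or_intror erefl); lra.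
have := key 1 (or_introl erefl); lra.
Qed.
End Trig.

Section Loss.
Variables (R : realType) (p : R).
Hypothesis hp : 0 < p < 1.
Let p0 : 0 < p. Proof. by case/andP: hp. Qed.
Let q0 : 0 < 1 - p. Proof. by rewrite subr_gt0; case/andP: hp. Qed.
Let c := 4 * (p * (1 - p)).

Lemma four_pq_gt0 : 0 < c. Proof. by rewrite mulr_gt0 // mulr_gt0. Qed.
Lemma four_pq_le1 : c <= 1. Proof. by have := sqr_ge0 (2 * p - 1); rewrite /c; lra. Qed.

(** Here om = 4 x^2/pi^2, where x is the argument of the sine in loss; the bound is
1 - cos^2 x >= 1 - (1 - om)^2. *)
Lemma loss_ge (s : R) : `|s| <= Num.sqrt (p * (1 - p)) * pi ->
  exists om : R, [/\ 0 <= om <= 1, c * om = 4 * s ^+ 2 / pi ^+ 2 &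
   c * om * (2 - om) <= loss p s].
Proof.
set v := Num.sqrt _ => hs.
have v0 : 0 < v by rewrite sqrtr_gt0 mulr_gt0.
have v2 : v ^+ 2 = p * (1 - p) by rewrite sqr_sqrtr // ltW // mulr_gt0.
have pi0 := pi_gt0 R.
set x := s / (2 * v).
have xE : s = 2 * v * x by rewrite /x mulrC divfK // mulf_neq0 ?gt_eqF.
have hx : `|x| <= pi / 2.
  rewrite /x normrM normfV (gtr0_norm (mulr_gt0 _ v0)) // ler_pdivrMr ?mulr_gt0 //.
  by apply: le_trans hs _; rewrite le_eqVlt; apply/orP; left; apply/eqP; field.
have cp := cos_le_parabola hx.
have c0 : 0 <= cos x.
  by apply: cos_ge0_pihalf; rewrite -ler_norml.
exists (4 * x ^+ 2 / pi ^+ 2); set om := 4 * x ^+ 2 / pi ^+ 2 in cp *.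
have om0 : 0 <= om by rewrite /om divr_ge0 ?sqr_ge0 // mulr_ge0 ?sqr_ge0.
split; first by apply/andP; split => //; lra.
  have pn := lt0r_neq0 pi0; rewrite /om /c -v2 xE.
  by move: (x) (v) (@pi R) pn => X V P pn; field.
rewrite /loss -/v -/c -/x -mulrA ler_pM2l ?four_pq_gt0 //.
have := cos2Dsin2 x; have : cos x ^+ 2 <= (1 - om) ^+ 2.
  by rewrite lerXn2r // nnegrE; lra.
by set C := cos x; set S := sin x; nra.
Qed.

Lemma sqrt_loss_le (s : R) : `|s| <= Num.sqrt (p * (1 - p)) * pi ->
  Num.sqrt (1 - loss p s) <= expR (- (2 * s ^+ 2 / pi ^+ 2)).
Proof.
move=> /loss_ge [om [/andP[om0 om1] omE hl]].
rewrite -(ger0_norm (expR_ge0 (- (2 * s ^+ 2 / pi ^+ 2)))) -sqrtr_sqr ler_wsqrtr //.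
rewrite -expRM_natl; apply: le_trans (expR_ge1Dx _).
rewrite mulrN lerD2l lerN2; apply: le_trans hl.
have -> : 2 * (2 * s ^+ 2 / pi ^+ 2) = c * om by rewrite omE; ring.
have c0 := four_pq_gt0; have co : 0 <= c * om by rewrite mulr_ge0 // ltW.
by apply: ler_peMr => //; lra.
Qed.

(** The quadratic term is needed when lambda is not small, see
chernoff_scalar. *)
Lemma one_sub_le_expR (G : R) : 0 <= G <= 1 -> 1 - G <= expR (- (G + G ^+ 2 / 4)).
Proof.
move=> /andP[G0 G1].
have h1 : (1 - G / 2) ^+ 2 <= expR (- G).
  have -> : - G = 2%:R * (- (G / 2)) by field.
  rewrite expRM_natl lerXn2r ?nnegrE ?expR_ge0 //; first lra.
  exact: expR_ge1Dx.
have h2 : 1 - G ^+ 2 / 4 <= expR (- (G ^+ 2 / 4)) by exact: expR_ge1Dx.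
have e1 : expR (- G) <= 1 by rewrite expR_le1 oppr_le0.
rewrite opprD expRD; apply: le_trans (_ : expR (- G) * (1 - G ^+ 2 / 4) <= _).
  by have := sqr_ge0 G; nra.
by rewrite ler_pM2l ?expR_gt0.
Qed.

(** At om = 1 in loss_ge this is exactly one_sub_le_expR.  For smaller om, the
factor 2 - om increases the linear term by more than the quadratic term
loses. *)
Lemma damped_loss_le (z s : R) : 0 <= z <= 1 -> `|s| <= Num.sqrt (p * (1 - p)) * pi ->
  1 - (1 - z) * loss p s <=
  expR (- ((1 - z) * (1 + (1 - z) * c / 4) * (4 * s ^+ 2 / pi ^+ 2))).
Proof.
move=> /andP[z0 z1] /loss_ge [om [/andP[om0 om1] <- hl]].
set y := 1 - z; have y0 : 0 <= y by rewrite subr_ge0.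
have y1 : y <= 1 by rewrite /y; lra.
have cc := four_pq_gt0; have c1 := four_pq_le1.
set G := y * (c * om * (2 - om)).
have om2 : 0 <= 2 - om by lra.
have G0 : 0 <= G by rewrite mulr_ge0 // mulr_ge0 // mulr_ge0 // ltW.
have o1 : om * (2 - om) <= 1 by have := sqr_ge0 (1 - om); lra.
have o0 : 0 <= om * (2 - om) by rewrite mulr_ge0 //; lra.
have G1 : G <= 1.
  have -> : G = y * (c * (om * (2 - om))) by rewrite /G; ring.
  have co : 0 <= c * (om * (2 - om)) by rewrite mulr_ge0 // ltW.
  apply: mulr_ile1 => //.
  by apply: mulr_ile1; rewrite ?(ltW cc).
apply: (le_trans (y := 1 - G)); first by rewrite lerD2l lerN2 /G ler_wpM2l.
apply: le_trans (one_sub_le_expR _) _; first by rewrite G0.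
rewrite ler_expR lerN2.
set k := y * c / 4; have k0 : 0 <= k by rewrite /k divr_ge0 ?mulr_ge0 // ltW.
have k1 : k <= 1 / 4 by rewrite /k; nra.
rewrite -subr_ge0.
have -> : G + G ^+ 2 / 4 - y * (1 + k) * (c * om) =
   y * (c * om) * ((1 - om) * (1 - k * (om ^+ 2 - 3 * om + 1))) by rewrite /G /k; field.
have w1 : 0 <= 3 * om - om ^+ 2 by nra.
have kw := mulr_ge0 k0 w1.
have co : 0 <= y * (c * om) by rewrite mulr_ge0 // mulr_ge0 // ltW.
by apply: mulr_ge0 => //; apply: mulr_ge0; lra.
Qed.

Lemma prod_damped_loss n (a : 'I_n -> R) (z : R) : 0 <= z <= 1 ->
  (forall i, `|a i| <= Num.sqrt (p * (1 - p)) * pi) ->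
  \prod_i (1 - (1 - z) * loss p (a i)) <=
  expR (- (2 * (1 - z) * (1 + (1 - z) * c / 4) * \sum_i (2 * a i ^+ 2 / pi ^+ 2))).
Proof.
move=> hz ha.
rewrite mulr_sumr -sumrN expR_sum.
apply: ler_prod => i _; apply/andP; split.
  case/andP: hz => z0 z1; have := loss_ge0 hp (a i); have := loss_le1 hp (a i); nra.
apply: le_trans (damped_loss_le hz (ha i)) _.
by rewrite le_eqVlt; apply/orP; left; apply/eqP; congr expR; ring.
Qed.

Lemma prod_sqrt_loss n (m : 'I_n -> bool) (a : 'I_n -> R) :
  (forall i, `|a i| <= Num.sqrt (p * (1 - p)) * pi) ->
  \prod_(i | ~~ m i) Num.sqrt (1 - loss p (a i)) <=
  expR (- \sum_(i | ~~ m i) (2 * a i ^+ 2 / pi ^+ 2)).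
Proof.
move=> ha; rewrite -sumrN expR_sum.
by apply: ler_prod => i _; rewrite sqrtr_ge0 sqrt_loss_le.
Qed.
End Loss.

(** * Numerical inequalities *)

Section Numeric.
Variable R : realType.
Local Notation e := (@expR R 1).

Let sq (a b x : R) : a <= x -> 0 <= a -> b <= a ^+ 2 -> b <= x ^+ 2.
Proof. by move=> ax a0 h; apply: le_trans h _; rewrite lerXn2r ?nnegrE //; lra. Qed.

Let dbl (x : R) : expR x = expR (x / 2) ^+ 2.
Proof. by rewrite -expRM_natl; congr expR; field. Qed.

Lemma is_derive_expRN (x : R) : is_derive x 1 (fun t => expR (0 + t * -1)) (- expR (- x)).
Proof.
have h : is_derive x 1 (fun t => expR (0 + t * -1)) (expR (0 + x * -1) * -1).
  by apply: (@is_derive1_comp R expR (fun t => 0 + t * -1)); exact: isd_aff.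
by apply: is_derive_eq h _; rewrite add0r !mulrN1.
Qed.

Lemma expR_ge_quad (x : R) : 0 <= x -> 1 + x + x ^+ 2 / 2 <= expR x.
Proof.
move=> x0.
have d (y : R) := isdB (is_derive_expR y)
  (isdD (isd_aff 1 1 y) (isdM (isdX 2 (isd_id y)) (isd_cst 2^-1 y))).
have := ge0_derive_le x0 d; rewrite expR0 => h.
suff : 1 - (1 + 0 * 1 + 0 ^+ 2 * 2^-1) <= expR x - (1 + x * 1 + x ^+ 2 * 2^-1).
  by rewrite expr0n /=; lra.
by apply: h => y /andP[y0 _] /=; have := expR_ge1Dx y; rewrite expr1; lra.
Qed.

Lemma expRN_le_quad (x : R) : 0 <= x -> expR (- x) <= 1 - x + x ^+ 2 / 2.
Proof.
move=> x0.
have d (y : R) := isdB (isdD (isd_aff 1 (-1) y) (isdM (isdX 2 (isd_id y)) (isd_cst 2^-1 y)))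
  (is_derive_expRN y).
have := ge0_derive_le x0 d; rewrite !add0r mul0r expR0 mulrN1 => h.
suff : 1 + 0 + 0 ^+ 2 * 2^-1 - 1 <= 1 + - x + x ^+ 2 * 2^-1 - expR (- x).
  by rewrite expr0n /=; lra.
rewrite addr0 in h *; apply: h => y /andP[y0 _] /=; have := expR_ge1Dx (- y); rewrite expr1; lra.
Qed.

Lemma expRN_ge_cubic (x : R) : 0 <= x -> 1 - x + x ^+ 2 / 2 - x ^+ 3 / 6 <= expR (- x).
Proof.
move=> x0.
have d (y : R) := isdB (is_derive_expRN y)
  (isdD (isdD (isd_aff 1 (-1) y) (isdM (isdX 2 (isd_id y)) (isd_cst 2^-1 y)))
        (isdM (isdX 3 (isd_id y)) (isd_cst (- 6^-1) y))).
have := ge0_derive_le x0 d; rewrite !add0r mul0r expR0 mulrN1 => h.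
suff : 1 - (1 + 0 + 0 ^+ 2 * 2^-1 + 0 ^+ 3 * - 6^-1) <=
   expR (- x) - (1 + - x + x ^+ 2 * 2^-1 + x ^+ 3 * - 6^-1).
  by rewrite !expr0n /=; lra.
by apply: h => y /andP[y0 _] /=; have := expRN_le_quad y0; rewrite expr1; lra.
Qed.

Lemma expR_07 : 2 <= expR (7 / 10 : R).
Proof.
rewrite dbl; apply: (@sq (1416 / 1000)); try lra.
rewrite dbl; apply: (@sq (119 / 100)); try lra.
by have h := @expR_ge_quad (7 / 10 / 2 / 2) ltac:(lra); lra.
Qed.

Lemma expRN1_ge : 4 / 11 <= expR (-1 : R).
Proof.
rewrite dbl; apply: (@sq (604 / 1000)); try lra.
have -> : -1 / 2 = - (1 / 2) :> R by lra.
by have h := @expRN_ge_cubic (1 / 2) ltac:(lra); lra.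
Qed.

Lemma expR1_le : e <= 11 / 4.
Proof.
have := expRN1_ge; have := expRxMexpNx_1 (1 : R); have := expR_gt0 (1 : R); nra.
Qed.

Lemma expR119_le : expR (11 / 9 : R) <= 347 / 100.
Proof.
have h : 100 / 347 <= expR (- (11 / 9) : R).
  rewrite dbl; apply: (@sq (537 / 1000)); try lra.
  have -> : - (11 / 9) / 2 = - (11 / 9 / 2) :> R by lra.
  by have h := @expRN_ge_cubic (11 / 9 / 2) ltac:(lra); lra.
have := expRxMexpNx_1 (11 / 9 : R); have := expR_gt0 (11 / 9 : R); nra.
Qed.

(** The factor 1 + (11/9 - y) is below exp(11/9 - y).  The point 11/9 is the largest
value at which expR_le_2x and remainder_scalar evaluate exp. *)
Lemma expR_le_rat (y : R) : y <= 11 / 9 -> expR y * (1 + (11 / 9 - y)) <= 347 / 100.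
Proof.
move=> hy; apply: le_trans expR119_le.
have -> : expR (11 / 9) = expR y * expR (11 / 9 - y) by rewrite -expRD; congr expR; ring.
by rewrite ler_pM2l ?expR_gt0 // expR_ge1Dx.
Qed.

(** For b in this range, g = lambda/(2 e b) <= lambda exp(-b), which makes the
Taylor bound of order 2 fit into the third term. *)
Lemma expR_le_2x (b : R) : 3 / 10 <= b <= 20 / 9 -> expR b <= 2 * e * b.
Proof.
move=> /andP[b1 b2].
have -> : expR b = e * expR (b - 1) by rewrite -expRD; congr expR; ring.
rewrite [2 * e]mulrC -mulrA ler_pM2l ?expR_gt0 //.
have [bb|bb] := leP b 1.
  have h := expR_ge1Dx (1 - b); have h2 := expRxMexpNx_1 (1 - b).
  rewrite opprB in h2; have h3 := expR_gt0 (b - 1); set y := expR (b - 1) in h2 h3 *.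
  have : y * (2 - b) <= 1 by rewrite -h2 mulrC ler_pM2r //; lra.
  by nra.
have := @expR_le_rat (b - 1); have h3 := expR_gt0 (b - 1).
set y := expR (b - 1) in h3 * => /(_ _) h; have {}h := h ltac:(lra).
by nra.
Qed.

(** The squared absolute moment of order r has at most the factor
2 lambda^2 (r/(4 e b))^r per degree, to be compared with the factor
lambda^2 exp(-2b) of S3^2.  For r near 9b/10, the quotient decays like a power of 79/100. *)
Lemma remainder_scalar (r : nat) (b : R) : (3 <= r)%N ->
  r.-1%:R <= 9 / 10 * b -> 9 / 10 * b < r%:R ->
  2 * (r%:R / (4 * e * b)) ^+ r <= expR (- (2 * b)).
Proof.
case: r => // r r2 /= h1 h2.
have e0 : 0 < e by exact: expR_gt0.
have rr : 2 <= r%:R :> R by rewrite (ler_nat _ 2).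
have b0 : 0 < b by lra.
set N : R := r.+1%:R in h2 *.
have NE : N = r%:R + 1 by rewrite /N natr1.
have N0 : 0 < N by lra.
set x := b / N.
have xb : b = N * x by rewrite /x mulrC divfK // gt_eqF.
have x0 : 0 < x by rewrite divr_gt0.
have x1 : x <= 10 / 9 by rewrite /x ler_pdivrMr //; lra.
have x2 : 74 / 100 <= x by rewrite /x ler_pdivlMr // NE; lra.
have key : expR (2 * x) <= 79 / 100 * (4 * e * x).
  have -> : expR (2 * x) = e * expR (2 * x - 1) by rewrite -expRD; congr expR; ring.
  have h := @expR_le_rat (2 * x - 1); have {}h := h ltac:(lra).
  have y0 := expR_gt0 (2 * x - 1); set y := expR (2 * x - 1) in h y0 *.
  have : y <= 316 / 100 * x by nra.
  by move=> hy; have := ler_wpM2l (ltW e0) hy; lra.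
have -> : N / (4 * e * b) = (4 * e * x)^-1.
  by rewrite xb; field; rewrite !gt_eqF.
have -> : - (2 * b) = r.+1%:R * (- (2 * x)) by rewrite xb -/N; ring.
rewrite expRM_natl.
have D0 : 0 < 4 * e * x by rewrite mulr_gt0 // mulr_gt0.
have h3 : (4 * e * x)^-1 <= 79 / 100 * expR (- (2 * x)).
  rewrite -[leLHS]mul1r ler_pdivrMr // -(ler_pM2r (expR_gt0 (2 * x))) mul1r.
  apply: le_trans key _; rewrite le_eqVlt; apply/orP; left; apply/eqP.
  transitivity (79 / 100 * (4 * e * x) * (expR (2 * x) * expR (- (2 * x)))); last by ring.
  by rewrite expRxMexpNx_1 mulr1.
have h4 : (4 * e * x)^-1 ^+ r.+1 <= (79 / 100 * expR (- (2 * x))) ^+ r.+1.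
  by rewrite lerXn2r ?nnegrE ?mulr_ge0 ?expR_ge0 // invr_ge0 ltW.
apply: le_trans (ler_wpM2l (ler0n R 2) h4) _.
rewrite exprMn mulrA ler_piMl ?exprn_ge0 ?expR_ge0 //.
have : (79 / 100 : R) ^+ r.+1 <= (79 / 100) ^+ 3.
  rewrite -(subnK r2) exprD ler_piMl ?exprn_ge0 //; try lra.
  by apply: exprn_ile1; lra.
by lra.
Qed.

(** Bernoulli's inequality (1 + 1/n)^m >= 1 + m/n, cleared of denominators. *)
Lemma bernoulli_pow (n m : nat) :
  n%:R ^+ m * (n%:R + m%:R) <= n%:R * n.+1%:R ^+ m :> R.
Proof.
elim: m => [|m IHm]; first by rewrite !expr0; lra.
rewrite !exprS [n%:R * (n.+1%:R * _)]mulrCA.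
apply: le_trans (_ : n.+1%:R * (n%:R ^+ m * (n%:R + m%:R)) <= _); last by rewrite ler_pM2l.
rewrite -mulrA mulrCA [leRHS]mulrCA; apply: ler_wpM2l; first by rewrite exprn_ge0.
rewrite -[n.+1%:R]natr1 -[m.+1%:R]natr1.
have : 0 <= m%:R :> R by []. have : 0 <= n%:R :> R by []. nra.
Qed.

(** For b < 3/10 one has g >= (6/10) lambda; with this value of g the second term
dominates u^2/2 as soon as the present inequality holds. *)
Lemma fact_le_pow (l : nat) : (2 <= l)%N ->
  (l.+1)`!%:R <= 2 * ((6 / 10) ^+ l.-1 * l%:R ^+ l.+1) :> R.
Proof.
suff step n : (2 <= n)%N ->
    (n.+1)`!%:R <= 2 * ((6 / 10) ^+ n.-1 * n%:R ^+ n.+1) :> R ->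
    (n.+2)`!%:R <= 2 * ((6 / 10) ^+ n * n.+1%:R ^+ n.+2) :> R.
  case: l => // -[//|l] _; elim: l => [|l IH]; last exact: step IH.
  by rewrite /=; have -> : 3`! = 6%N by []; lra.
move=> n2' IH; rewrite factS natrM; set F := (n.+1)`!%:R in IH *.
have n2 : 2 <= n%:R :> R by rewrite (ler_nat _ 2).
have n0 : 0 < n%:R :> R by lra.
have bern : n%:R ^+ n.+1 * (2 * n%:R + 1) <= n%:R * n.+1%:R ^+ n.+1 :> R.
  apply: le_trans (bernoulli_pow n n.+1); rewrite le_eqVlt; apply/orP; left; apply/eqP.
  by congr (_ * _); rewrite -[n.+1%:R]natr1; ring.
have -> : (6 / 10) ^+ n = (6 / 10) ^+ n.-1.+1 :> R by rewrite prednK // ltnW.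
rewrite [_ ^+ n.-1.+1]exprS [n.+1%:R ^+ n.+2]exprS.
set P := (6 / 10) ^+ n.-1 in IH *.
have P0 : 0 <= P by rewrite exprn_ge0 //; lra.
set A := n%:R ^+ n.+1 in IH bern *; set C := n.+1%:R ^+ n.+1 in bern *.
have A0 : 0 <= A by rewrite exprn_ge0 // ltW.
have n1E : n.+1%:R = n%:R + 1 :> R by rewrite natr1.
have n22E : n.+2%:R = n%:R + 2 :> R by rewrite -!natr1; ring.
rewrite n22E n1E.
apply: le_trans (_ : (n%:R + 2) * (2 * (P * A)) <= _); first by rewrite ler_pM2l //; lra.
have PA : 0 <= P * A by exact: mulr_ge0.
have h := ler_wpM2l P0 bern.
rewrite -(ler_pM2l n0).
have q (x : R) : 2 <= x -> x * (x + 2) <= 6 / 10 * ((x + 1) * (2 * x + 1)).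
  by move=> x2; have := sqr_ge0 (x - 2); lra.
have := ler_wpM2l PA (q _ n2).
have : (n%:R + 1) * (P * (A * (2 * n%:R + 1))) <= (n%:R + 1) * (P * (n%:R * C)).
  by rewrite ler_pM2l //; lra.
by lra.
Qed.

(** The squared moment M_j^2 will be bounded by Q^d exp(-2 kap L), with N standing
for ln(1/lambda).  The given z minimizes z^(-j) exp(2 z (b + N)).  The two claims on Q are the
comparisons with exp(-2L) at the ends of the range 0 <= L <= d(b + N).

When lambda is not small, the estimate of z^(-j) exp(2 z (b + N)) alone is too weak,
and the second-order gain lam (1 - lam) in kap makes up for it. *)
Lemma chernoff_scalar (j : nat) (b N lam z : R) : (2 <= j)%N ->
  j%:R <= 9 / 10 * b -> lam = expR (- N) -> lam <= 1 / 2 ->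
  z = j%:R / (2 * (b + N)) ->
  let kap := (1 - z) * (1 + (1 - z) * (4 * (lam * (1 - lam))) / 4) in
  let Q := 2 * lam * ((j.*2.-1)%:R / (4 * e * b) / z) ^+ j in
  [/\ 0 < z < 1, Q <= 1 & Q * expR (2 * (1 - kap) * (b + N)) <= 1].
Proof.
move=> j2 jb lamE lam2 zE kap Q.
have jr : 2 <= j%:R :> R by rewrite (ler_nat _ 2).
have e0 : 0 < e by exact: expR_gt0.
have lam0 : 0 < lam by rewrite lamE expR_gt0.
have N2 : 1 / 2 <= N by have := expR_ge1Dx (- N); rewrite -lamE; lra.
have b2 : 20 / 9 <= b by lra.
have bN : 0 < b + N by lra.
have z0 : 0 < z by rewrite zE divr_gt0 ?mulr_gt0 //; lra.
have z1 : z <= 45 / 100 by rewrite zE ler_pdivrMr ?mulr_gt0 //; lra.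
have zj : 2 * (b + N) * z = j%:R by rewrite zE mulrC divfK // mulf_neq0 // gt_eqF.
have Qle : Q <= expR (2 / 10 - N / 10 - j%:R).
  have base : (j.*2.-1)%:R / (4 * e * b) / z =
     (1 - (2 * j%:R)^-1) * (1 + N / b) * expR (-1).
    have -> : (j.*2.-1)%:R = 2 * j%:R - 1 :> R.
      by rewrite -subn1 natrB ?double_gt0 ?(ltnW j2) // -mul2n natrM.
    by rewrite expRN zE; field; rewrite !gt_eqF //; lra.
  rewrite /Q base !exprMn -expRM_natl mulrN1.
  have h1 : (1 - (2 * j%:R)^-1) ^+ j <= expR (- (1 / 2)) :> R.
    have E : j%:R * (- (2 * j%:R)^-1) = - (1 / 2) :> R by field; lra.
    rewrite -E expRM_natl lerXn2r ?nnegrE ?expR_ge0 ?expR_ge1Dx //.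
    by rewrite subr_ge0 invf_le1; lra.
  have h2 : (1 + N / b) ^+ j <= expR (9 / 10 * N).
    apply: le_trans (_ : expR (j%:R * (N / b)) <= _).
      rewrite expRM_natl lerXn2r ?nnegrE ?expR_ge0 ?expR_ge1Dx //.
      by rewrite addr_ge0 // divr_ge0; lra.
    rewrite ler_expR mulrCA mulrC ler_wpM2r //; first by lra.
    by rewrite ler_pdivrMr //; lra.
  have h3 : 2 * lam <= expR (7 / 10 - N).
    by rewrite lamE expRD ler_pM2r ?expR_gt0 // expR_07.
  have -> : 2 / 10 - N / 10 - j%:R = (7 / 10 - N) + (- (1 / 2)) + (9 / 10 * N) + - j%:R by lra.
  rewrite !expRD.
  rewrite !mulrA ler_pM2r ?expR_gt0 //.
  have p1 : 0 <= 1 - (2 * j%:R)^-1 :> R by rewrite subr_ge0 invf_le1; lra.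
  have p2 : 0 <= 1 + N / b by rewrite addr_ge0 // divr_ge0; lra.
  have l0 : 0 <= 2 * lam by lra.
  have p1j : 0 <= (1 - (2 * j%:R)^-1) ^+ j :> R by rewrite exprn_ge0.
  have p2j : 0 <= (1 + N / b) ^+ j by rewrite exprn_ge0.
  rewrite expRD in h3.
  by apply: ler_pM => //; [rewrite mulr_ge0|apply: ler_pM].
split; first by apply/andP; split => //; lra.
  by apply: le_trans Qle _; rewrite expR_le1; lra.
apply: le_trans (ler_wpM2r (expR_ge0 _) Qle) _.
rewrite -expRD expR_le1.
set y := 1 - z in kap *.
have -> : 2 * (1 - kap) * (b + N) = j%:R - 2 * (y * (y * (lam * (1 - lam)))) * (b + N).
  by rewrite -zj /kap /y; field.
have y1 : 55 / 100 <= y by rewrite /y; lra.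
have ll0 : 0 <= lam * (1 - lam) by rewrite mulr_ge0; lra.
have G0 : 0 <= 2 * (y * (y * (lam * (1 - lam)))) * (b + N).
  by rewrite !mulr_ge0 //; lra.
(* For N >= 2 the term N/10 in Qle wins; for N < 2, lam is bounded below. *)
have [N2'|N2'] := leP 2 N; first by lra.
have lamg : 13 / 100 <= lam.
  have h := expRN1_ge; rewrite lamE; apply: (le_trans (y := expR (-2))).
    have -> : -2 = 2%:R * (-1) :> R by ring.
    by rewrite expRM_natl; nra.
  by rewrite ler_expR; lra.
have l1 : 1131 / 10000 <= lam * (1 - lam) by nra.
have y2 : 3025 / 10000 <= y * y by nra.
have l2 : 342 / 10000 <= y * y * (lam * (1 - lam)) by nra.
have : 342 / 10000 * (27 / 10) <= y * y * (lam * (1 - lam)) * (b + N) by nra.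
by lra.
Qed.
End Numeric.

(** * The bound on the cube of bits *)

Lemma leq_4S_expn l : (2 <= l)%N -> (4 * l.+1 <= 2 ^ l.+1 * l)%N.
Proof.
case: l => [//|[//|m]] _; rewrite !expnS; have : (0 < 2 ^ m)%N by rewrite expn_gt0.
by nia.
Qed.

(** Final bookkeeping when the expansion stops at order 9b/10: x is the inverse
factorial left over by sum_inv_fact, which makes room for the remainder E. *)
Lemma absorb_tail (R : realDomainType) (A x y E H S ep s : R) :
  A + ep <= H -> y <= ep -> E <= S * x -> 0 <= y * x -> 0 <= s ->
  A + (y + S) * (1 - x) + E <= H + (s + S).
Proof. by move=> *; lra. Qed.

(** Final bookkeeping when the expansion stops at order l: the remainder is the
second term s, and nothing has to be absorbed. *)
Lemma absorb_order (R : realDomainType) (A x y H S ep s : R) :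
  A + ep <= H -> y <= ep -> 0 <= (y + S) * x ->
  A + (y + S) * (1 - x) + s <= H + (s + S).
Proof. by move=> *; lra. Qed.

Section Model.
Variables (R : realType) (p : R).
Hypothesis hp : 0 < p < 1.
Local Notation chi := (chi p).
Local Notation bexp := (bexp p).
Local Notation pdeg := (pdeg p).
Local Notation lin_form := (lin_form p).
Let lam := Num.min p (1 - p).
Let lam0 : 0 < lam. Proof. exact: lam_gt0. Qed.
Let lam2 : lam <= 1 / 2. Proof. by have := lam_le p; rewrite -/lam; lra. Qed.
Let lam1 : lam <= 1. Proof. by apply: le_trans lam2 _; lra. Qed.

Section Moments.
Variables (n d : nat) (Z : seq bool -> R) (g : R).
Hypotheses (dZ : pdeg n d Z) (g0 : 0 < g)
  (gE : g ^+ d = bexp n (fun s => Z s ^+ 2)).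
Let w := g / (2 * lam).

Let w0 : 0 < w. Proof. by rewrite divr_gt0 // mulr_gt0. Qed.

(** Hypercontractivity, arranged as a d-th power to match the shape of S3. *)
Lemma even_moment k : bexp n (fun s => Z s ^+ k.+1.*2) <=
  (2 * lam * (k.*2.+1%:R * w) ^+ k.+1) ^+ d.
Proof.
pose tau := (2 * lam) `^ (k.+1%:R^-1).
have l0 : 0 < 2 * lam by rewrite mulr_gt0.
have tau0 : 0 < tau by exact: powR_gt0.
have tauE : tau ^+ k.+1 = 2 * lam.
  by rewrite -powR_mulrn ?ltW // -powRrM mulVf ?powRr1 ?ltW.
apply: le_trans (hypercontractive hp tau0 tauE dZ) _.
rewrite -gE -exprMn -!exprM mulnC !exprM le_eqVlt; apply/orP; left; apply/eqP.
congr (_ ^+ _).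
have -> : hyper_const p tau k * g = tau * (k.*2.+1%:R * w).
  by rewrite /hyper_const /w -/lam; field; rewrite gt_eqF.
by rewrite exprMn tauE.
Qed.

(** An odd moment is the geometric mean of the two neighbouring even ones, by
Cauchy-Schwarz. *)
Lemma abs_moment q : (2 <= q)%N -> bexp n (fun s => `|Z s| ^+ q) ^+ 2 <=
  ((2 * lam) ^+ 2 * (q.-1%:R ^+ q.-1 * q%:R * w ^+ q)) ^+ d.
Proof.
have ev m s : `|Z s| ^+ m.*2 = Z s ^+ m.*2.
  by rewrite -mul2n !exprM real_normK ?num_real.
have l0 : 0 <= 2 * lam by rewrite mulr_ge0 // ltW.
have wn m : 0 <= w ^+ m by rewrite exprn_ge0 // ltW.
have nn m k : 0 <= m%:R ^+ k :> R by rewrite exprn_ge0.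
case: q => [//|[//|q]] _.
have [k [->|->]] : exists k, q = k.*2 \/ q = k.*2.+1.
  by exists q./2; have := odd_double_half q; move: (q./2) => k; case: (odd q) => h; [right|left]; rewrite -h ?add1n ?add0n.
  rewrite (eq_bexp (g := fun s => Z s ^+ k.+1.*2)) => [|s _]; last by rewrite -doubleS ev.
  have h := even_moment k.
  have b0 : 0 <= bexp n (fun s => Z s ^+ k.+1.*2).
    by apply: (bexp_ge0 hp) => s; rewrite -ev exprn_ge0.
  have : bexp n (fun s => Z s ^+ k.+1.*2) ^+ 2 <=
      ((2 * lam * (k.*2.+1%:R * w) ^+ k.+1) ^+ d) ^+ 2.
    by rewrite lerXn2r ?nnegrE // exprn_ge0 // mulr_ge0 // exprn_ge0 // mulr_ge0 // ltW.
  move=> {}h; apply: le_trans h _; rewrite -exprM mulnC exprM.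
  apply: lerXn2r; rewrite ?nnegrE; first exact: sqr_ge0.
    by rewrite mulr_ge0 ?sqr_ge0 // mulr_ge0 // mulr_ge0.
  rewrite exprMn ler_wpM2l ?sqr_ge0 // -exprM exprMn.
  have -> : (k.+1 * 2 = k.*2.+2)%N by rewrite muln2 doubleS.
  rewrite ler_wpM2r // /= exprSr ler_wpM2l // ler_nat //.
rewrite (eq_bexp (g := fun s => `|Z s| ^+ k.+1 * `|Z s| ^+ k.+2)) => [|s _]; last first.
  by rewrite -exprD; congr (_ ^+ _); rewrite addSn addnS -addnn; lia.
apply: le_trans (bexp_CS hp _ _ _) _.
rewrite (eq_bexp (g := fun s => Z s ^+ k.+1.*2)) => [|s _]; last by rewrite -exprM muln2 ev.
rewrite [X in _ * X](eq_bexp (g := fun s => Z s ^+ k.+2.*2)) => [|s _]; last by rewrite -exprM muln2 ev.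
have z0 m : 0 <= bexp n (fun s => Z s ^+ m.*2).
  by apply: (bexp_ge0 hp) => s; rewrite -ev exprn_ge0.
apply: le_trans (ler_pM (z0 _) (z0 _) (even_moment k) (even_moment k.+1)) _.
have c0 m j : 0 <= (m%:R * w) ^+ j by rewrite exprn_ge0 // mulr_ge0 // ltW.
rewrite -exprMn; apply: lerXn2r; rewrite ?nnegrE.
- by rewrite mulr_ge0 // mulr_ge0.
- by rewrite mulr_ge0 ?sqr_ge0 // mulr_ge0 // mulr_ge0.
rewrite mulrACA -expr2 ler_wpM2l ?sqr_ge0 // /= [(_ * w) ^+ k.+1]exprMn [(_ * w) ^+ k.+2]exprMn mulrACA -exprD.
have -> : (k.+1 + k.+2 = k.*2.+3)%N by rewrite addSn addnS -addnn; lia.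
rewrite ler_wpM2r // [_ ^+ k.+2]exprSr mulrA.
have -> : k.+1.*2.+1 = k.*2.+3 by rewrite doubleS.
rewrite ler_wpM2r // -exprMn.
have -> : k.*2.+2 = (2 * k.+1)%N by lia.
rewrite exprM; apply: lerXn2r; rewrite ?nnegrE ?sqr_ge0 //.
by rewrite -natrM -natrX ler_nat -mulnn; nia.
Qed.
End Moments.

Section Bound.
Variables (n d l : nat) (a : 'I_n -> R) (c : {set 'I_n} -> R).
Hypothesis hc : forall S : {set 'I_n}, c S != 0 -> (#|S| <= d)%N.
Hypothesis ha : forall i, `|a i| <= Num.sqrt (p * (1 - p)) * pi.

(** The multilinear polynomial as a function of the bits. *)
Definition bit_poly (s : seq bool) : R :=
  \sum_(S : {set 'I_n}) c S * \prod_(i in S) chi (nth false s i).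
Local Notation Z := bit_poly.

Let monE (S : {set 'I_n}) s :
  \prod_(i in S) chi (nth false s i) = monomial p (fun i => i \in S) s.
Proof. by rewrite /monomial -big_mkcond. Qed.

Lemma pdeg_bit_poly : pdeg n d Z.
Proof.
apply: pdeg_sum => S _; have [->|/hc cS] := eqVneq (c S) 0.
  by apply: (eq_pdeg (f := fun=> 0)) => [s|]; [rewrite mul0r|exact: pdeg_cst].
rewrite -[d]add0n; apply: (pdegM hp) => //; first exact: pdeg_cst.
apply: (eq_pdeg (f := monomial p (fun i => i \in S))) => [s|]; first by rewrite monE.
apply: pdeg_le (pdeg_monomial p _); apply: leq_trans cS.
by rewrite -sum1_card [leqRHS]big_mkcond /=; apply: leq_sum => i _; case: (i \in S).
Qed.

Variable eps : R.
Hypothesis heps : forall S : {set 'I_n}, (#|S| <= d)%N ->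
  expR (- \sum_(i | i \notin S) (2 * a i ^+ 2 / pi ^+ 2)) <= eps.

Let B := \sum_(S : {set 'I_n}) `|c S|.

(** Each monomial sees the decay of all variables outside its support, of which eps is a
common bound. *)
Lemma first_order th : `|bexp n (fun s => cos (th + lin_form a s) * Z s)| <= eps * B.
Proof.
rewrite (eq_bexp (g := fun s => \sum_(S : {set 'I_n})
   c S * (cos (th + lin_form a s) * monomial p (fun i => i \in S) s))); last first.
  by move=> s _; rewrite mulr_sumr; apply: eq_bigr => S _; rewrite -monE mulrCA.
rewrite bexp_sum /B mulr_sumr; apply: le_trans (ler_norm_sum _ _ _) _.
apply: ler_sum => S _; rewrite bexpZ normrM [leRHS]mulrC.
have [->|/hc cS] := eqVneq (c S) 0; first by rewrite normr0 !mul0r.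
apply: ler_wpM2l => //; apply: le_trans (monomial_wave hp _ _ _) _.
exact: le_trans (prod_sqrt_loss hp (fun i => i \in S) ha) (heps cS).
Qed.

(** The bounds m on the mixed moments are uniform in the phase, because the j-th
derivative of cos is a phase shift. *)
Lemma taylor_bexp r (m : nat -> R) :
  (forall j th, (j < r)%N ->
     `|bexp n (fun s => cos (th + lin_form a s) * Z s ^+ j.+1)| <= m j.+1) ->
  forall th, `|bexp n (fun s => cos (th + lin_form a s + Z s)) -
               bexp n (fun s => cos (th + lin_form a s))| <=
    \sum_(j < r) m j.+1 / (j.+1)`!%:R + bexp n (fun s => `|Z s| ^+ r.+1) / (r.+1)`!%:R.
Proof.
move=> hm th.
have -> : bexp n (fun s => cos (th + lin_form a s + Z s)) - bexp n (fun s => cos (th + lin_form a s)) =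
  \sum_(j < r) (bexp n (fun s => cos (th + j.+1%:R * (pi / 2) + lin_form a s) * Z s ^+ j.+1)
       / (j.+1)`!%:R) + bexp n (fun s => cos_rem r.+1 (th + lin_form a s) (Z s)).
  rewrite (eq_bexp (f := fun s => cos (th + lin_form a s + Z s))
    (g := fun s => cos (th + lin_form a s) +
     (\sum_(j < r) (((j.+1)`!%:R)^-1 *
        (cos (th + j.+1%:R * (pi / 2) + lin_form a s) * Z s ^+ j.+1)) +
      cos_rem r.+1 (th + lin_form a s) (Z s)))); last first.
    move=> s _; rewrite /cos_rem big_ord_recl mul0r addr0 expr0 fact0 divr1 mulr1.
    rewrite [X in _ + (X + _)](_ : _ = \sum_(i < r)
      cos (th + lin_form a s + (bump 0 i)%:R * (pi / 2)) * (Z s ^+ bump 0 i / (bump 0 i)`!%:R)).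
      by ring.
    apply: eq_bigr => i _; rewrite /bump leq0n add1n.
    have -> : th + i.+1%:R * (pi / 2) + lin_form a s = th + lin_form a s + i.+1%:R * (pi / 2) by ring.
    by rewrite [RHS]mulrA mulrC.
  rewrite bexpD addrC addKr bexpD bexp_sum; congr (_ + _).
  by apply: eq_bigr => j _; rewrite bexpZ mulrC.
apply: le_trans (ler_normD _ _) _; apply: lerD.
  apply: le_trans (ler_norm_sum _ _ _) _; apply: ler_sum => j _.
  rewrite normrM normfV (ger0_norm (ler0n R (j.+1)`!)) ler_wpM2r ?invr_ge0 //; exact: hm.
apply: le_trans (ler_norm_bexp hp _ _) _.
rewrite mulrC -bexpZ; apply: (bexp_le hp) => s _.
by rewrite mulrC; exact: cos_taylor.
Qed.

Local Notation e := (@expR R 1).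
Let L := \sum_i (2 * a i ^+ 2 / pi ^+ 2).
Variable g : R.
Hypotheses (g0 : 0 < g) (gE : g ^+ d = bexp n (fun s => Z s ^+ 2)).
Let b := lam / (2 * e * g).
Let S3 := (lam * expR (- b)) ^+ d.

Let b0 : 0 < b. Proof. by rewrite divr_gt0 ?mulr_gt0 ?expR_gt0. Qed.

Let wE : g / (2 * lam) = (4 * e * b)^-1.
Proof. by rewrite /b; field; rewrite !gt_eqF ?expR_gt0. Qed.

(** The square of the moment is at most Q^d exp(-2 kap L), by lowdeg_wave and
even_moment.  If L is at most d(b + ln(1/lambda)) this is below exp(-2L);
otherwise it is below its value at the threshold, which is S3^2. *)
Lemma power_moment j th : (2 <= j)%N -> j%:R <= 9 / 10 * b ->
  `|bexp n (fun s => cos (th + lin_form a s) * Z s ^+ j)| <= expR (- L) + S3.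
Proof.
move=> j2 jb.
pose N := - ln lam.
have lamN : lam = expR (- N) by rewrite opprK lnK // posrE.
pose z := j%:R / (2 * (b + N)).
have [/andP[z0 z1] Q1 Q2] := chernoff_scalar j2 jb lamN lam2 (erefl z).
set y := 1 - z in Q2; set kap := y * _ in Q2; set Q := 2 * lam * _ in Q1 Q2.
set X := `|_|.
have N0 : 0 <= N by rewrite oppr_ge0; apply: ln_le0; exact: lam1.
have lamq : lam * (1 - lam) = p * (1 - p).
  by rewrite /lam; case: (leP p (1 - p)) => _ //; ring.
have L0 : 0 <= L.
  by apply: sumr_ge0 => i _; rewrite divr_ge0 ?sqr_ge0 // mulr_ge0 ?sqr_ge0.
have z01 : 0 < z <= 1 by rewrite z0 ltW.
have z01' : 0 <= z <= 1 by rewrite !ltW.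
have Q0 : 0 <= Q.
  rewrite mulr_ge0 ?exprn_ge0 //; first by rewrite mulr_ge0 // ltW.
  by rewrite divr_ge0 ?(ltW z0) // divr_ge0 // mulr_ge0 ?(ltW b0) // mulr_ge0 ?expR_ge0.
have kap0 : 0 <= kap.
  have y0 : 0 <= y by rewrite /y; lra.
  rewrite mulr_ge0 // addr_ge0 // divr_ge0 // mulr_ge0 // mulr_ge0 // mulr_ge0 ?(ltW lam0) //.
  by rewrite subr_ge0; exact: lam1.
have main : X ^+ 2 <= Q ^+ d * expR (- (2 * kap * L)).
  have h := lowdeg_wave hp a th z01 (pdegX hp j pdeg_bit_poly).
  have hz : 0 < z ^+ (d * j) by rewrite exprn_gt0.
  rewrite real_normK ?num_real // -(ler_pM2r hz); apply: le_trans h _.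
  have -> : Q ^+ d * expR (- (2 * kap * L)) * z ^+ (d * j) =
    expR (- (2 * kap * L)) * (Q * z ^+ j) ^+ d.
    have E : (z ^+ j) ^+ d = z ^+ (d * j) by rewrite -exprM mulnC.
    by rewrite [(Q * _) ^+ d]exprMn E mulrAC mulrC mulrA.
  apply: ler_pM.
  - apply: prodr_ge0 => i _.
    by have := loss_ge0 hp (a i); have := loss_le1 hp (a i); nra.
  - by apply: (bexp_ge0 hp) => s; exact: sqr_ge0.
  - apply: le_trans (prod_damped_loss hp z01' ha) _.
    by rewrite -/y -/L -lamq /kap mulrA.
  rewrite (eq_bexp (g := fun s => Z s ^+ j.-1.+1.*2)) => [|s _]; last first.
    by rewrite prednK ?(ltnW j2) // -exprM muln2.
  apply: le_trans (even_moment pdeg_bit_poly gE j.-1) _.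
  rewrite wE le_eqVlt; apply/orP; left; apply/eqP; congr (_ ^+ _).
  rewrite prednK ?(ltnW j2) // /Q -[RHS]mulrA -[X in _ = _ * X]exprMn divfK ?gt_eqF //.
  have -> // : (j.-1.*2.+1 = j.*2.-1)%N by clear -j2; case: j j2.
have S30 : 0 <= S3 by rewrite exprn_ge0 // mulr_ge0 ?expR_ge0 // ltW.
have sqle (x : R) : 0 <= x -> X ^+ 2 <= x ^+ 2 -> X <= x.
  by move=> x0; rewrite ler_pXn2r ?nnegrE // /X normr_ge0.
have bN0 : 0 <= b + N by rewrite addr_ge0 // ltW.
have [hL|hL] := leP L (d%:R * (b + N)).
  apply: le_trans (_ : expR (- L) <= _); last by rewrite lerDl.
  apply: sqle; first exact: expR_ge0.
  apply: le_trans main _.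
  have -> : expR (- L) ^+ 2 = expR (- (2 * L)) by rewrite -expRM_natl; congr expR; ring.
  have -> : - (2 * kap * L) = 2 * (1 - kap) * L + - (2 * L) by ring.
  rewrite expRD mulrA ler_piMl ?expR_ge0 //.
  have [k1|k1] := leP 1 kap.
    apply: mulr_ile1; rewrite ?exprn_ge0 ?expR_ge0 //; first exact: exprn_ile1.
    by rewrite expR_le1; nra.
  apply: le_trans (_ : Q ^+ d * expR (2 * (1 - kap) * (b + N)) ^+ d <= _).
    rewrite ler_wpM2l ?exprn_ge0 // -expRM_natl ler_expR mulrCA ler_wpM2l //.
    by lra.
  by rewrite -exprMn exprn_ile1 // mulr_ge0 // expR_ge0.
apply: le_trans (_ : S3 <= _); last by rewrite lerDr expR_ge0.
apply: sqle => //; apply: le_trans main _.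
have -> : S3 ^+ 2 = expR (- (2 * (b + N))) ^+ d.
  rewrite /S3 [lam in lam * _]lamN -expRD -exprM mulnC exprM; congr (_ ^+ _).
  by rewrite -expRM_natl; congr expR; ring.
apply: le_trans (_ : (Q * expR (2 * (1 - kap) * (b + N)) * expR (- (2 * (b + N)))) ^+ d <= _).
  rewrite -[Q * _ * _]mulrA -expRD [(Q * _) ^+ d]exprMn ler_wpM2l ?exprn_ge0 // -expRM_natl ler_expR.
  have := ler_wpM2l kap0 (ltW hL); lra.
apply: lerXn2r; rewrite ?nnegrE ?expR_ge0 //.
  by rewrite mulr_ge0 ?expR_ge0 // mulr_ge0 ?expR_ge0.
by apply: ler_piMl; rewrite ?expR_ge0.
Qed.

(** The defect 1/(r+1)! is what pays for the remainder of the expansion. *)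
Lemma sum_inv_fact r : \sum_(j < r) ((j.+2)`!%:R : R)^-1 <= 1 - (r.+1)`!%:R^-1.
Proof.
elim: r => [|r IH]; first by rewrite big_ord0 invr1 subrr.
rewrite big_ord_recr /=; apply: le_trans (lerD IH (lexx _)) _.
rewrite [(r.+2)`!]factS natrM; set F : R := (r.+1)`!%:R.
have F0 : 0 < F by rewrite ltr0n fact_gt0.
have r2 : 2 <= r.+2%:R :> R by rewrite (ler_nat _ 2).
rewrite -subr_ge0.
have E (x y : R) : x != 0 -> y != 0 ->
    1 - (x * y)^-1 - (1 - y^-1 + (x * y)^-1) = (x - 2) / (x * y).
  by move=> x0 y0; field; apply/andP.
have r20 : r.+2%:R != 0 :> R by rewrite pnatr_eq0.
rewrite (E _ _ r20 (lt0r_neq0 F0)); apply: divr_ge0; first by rewrite subr_ge0.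
by rewrite mulr_ge0 // ltW.
Qed.

Let w := g / (2 * lam).
Let w0 : 0 < w. Proof. by rewrite divr_gt0 // mulr_gt0. Qed.
Let gw : g = 2 * lam * w.
Proof. by rewrite /w mulrC divfK // mulf_neq0 // gt_eqF. Qed.

Let absE (r : nat) : 0 <= bexp n (fun s => `|Z s| ^+ r).
Proof. by apply: (bexp_ge0 hp) => s; rewrite exprn_ge0. Qed.

Let E2 : bexp n (fun s => `|Z s| ^+ 2) = g ^+ d.
Proof. by rewrite gE; apply: eq_bexp => s _; rewrite real_normK ?num_real. Qed.

Let S30 : 0 <= S3.
Proof. by rewrite exprn_ge0 // mulr_ge0 ?expR_ge0 // ltW. Qed.

Lemma remainder_tail r : (3 <= r)%N -> r.-1%:R <= 9 / 10 * b -> 9 / 10 * b < r%:R ->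
  bexp n (fun s => `|Z s| ^+ r) <= S3.
Proof.
move=> r3 r1 r2; rewrite -(ler_pXn2r (n := 2)) ?nnegrE //.
apply: le_trans (abs_moment pdeg_bit_poly g0 gE (ltnW r3)) _.
rewrite -/w -exprM mulnC exprM; apply: lerXn2r; rewrite ?nnegrE ?sqr_ge0 //.
  by rewrite mulr_ge0 ?sqr_ge0 // mulr_ge0 ?mulr_ge0 ?exprn_ge0 // ltW.
have rs := remainder_scalar r3 r1 r2.
rewrite [(2 * lam) ^+ 2]exprMn [(lam * _) ^+ 2]exprMn -expRM_natl mulrAC mulrC.
rewrite ler_wpM2l ?sqr_ge0 //; have -> : 2%:R * - b = - (2 * b) by ring.
apply: le_trans rs.
have -> : r%:R / (4 * e * b) = r%:R * w by rewrite -wE.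
rewrite [(r%:R * w) ^+ r]exprMn !mulrA ler_wpM2r ?exprn_ge0 ?(ltW w0) //.
have := bernoulli_pow R r.-1 r.-1; rewrite prednK ?(ltnW (ltnW r3)) //.
have m0 : 0 < r.-1%:R :> R by rewrite ltr0n; case: (r) r3 => [|[]].
have -> : r.-1%:R + r.-1%:R = r.-1%:R * 2 :> R by ring.
rewrite mulrCA ler_pM2l // => h.
have -> : r%:R ^+ r = r%:R ^+ r.-1 * r%:R :> R by rewrite -exprSr prednK ?(ltnW (ltnW r3)).
have := ler_wpM2r (ler0n R r) h; lra.
Qed.

Variable s2 : R.
Hypotheses (s20 : 0 <= s2)
  (s2E : (s2 * (l.+1)`!%:R) ^+ 2 = (lam ^+ 2 * (2 * l%:R * w) ^+ l.+1) ^+ d).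

Let f0 : 0 < (l.+1)`!%:R :> R. Proof. by rewrite ltr0n fact_gt0. Qed.

(** The moment bound and the square of the second term have the same shape
lambda^2 ... w^(l+1) to the power d; the numerical factors compare by
4(l+1) <= 2^(l+1) l. *)
Lemma remainder_order : (2 <= l)%N ->
  bexp n (fun s => `|Z s| ^+ l.+1) / (l.+1)`!%:R <= s2.
Proof.
move=> l2; rewrite ler_pdivrMr // -(ler_pXn2r (n := 2)) ?nnegrE ?mulr_ge0 ?(ltW f0) //.
rewrite s2E; apply: le_trans (abs_moment pdeg_bit_poly g0 gE (leqW l2)) _; rewrite -/w.
have wl : 0 <= w ^+ l.+1 by rewrite exprn_ge0 // ltW.
apply: lerXn2r; rewrite ?nnegrE.
- by rewrite mulr_ge0 ?sqr_ge0 // mulr_ge0 // mulr_ge0 // exprn_ge0.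
- have : 0 <= 2 * l%:R * w by rewrite mulr_ge0 ?(ltW w0) // mulr_ge0.
  by move=> h; rewrite mulr_ge0 ?sqr_ge0 // exprn_ge0.
have h : 4 * l.+1%:R <= 2 ^+ l.+1 * l%:R :> R.
  rewrite -natrX -!natrM ler_nat; exact: leq_4S_expn.
have -> : (2 * l%:R * w) ^+ l.+1 = 2 ^+ l.+1 * (l%:R ^+ l * l%:R) * w ^+ l.+1.
  by rewrite [LHS]exprMn [(2 * _) ^+ _]exprMn [l%:R ^+ l.+1]exprSr.
rewrite /=; move: h wl; set A : R := l%:R ^+ l; set W := w ^+ l.+1.
move=> h wl.
have -> : (2 * lam) ^+ 2 * (A * l.+1%:R * W) = lam ^+ 2 * A * W * (4 * l.+1%:R) by ring.
have -> : lam ^+ 2 * (2 ^+ l.+1 * (A * l%:R) * W) = lam ^+ 2 * A * W * (2 ^+ l.+1 * l%:R) by ring.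
apply: ler_wpM2l => //.
by rewrite mulr_ge0 // mulr_ge0 ?sqr_ge0 // exprn_ge0.
Qed.

Hypotheses (d2 : (2 <= d)%N) (l0 : (0 < l)%N) (heL : expR (- L) <= eps).

(** The three ranges of b correspond to where the remainder goes.  For small b, that
is for large u, the second term dominates u^2/2; in the middle range the third one
does; for large b, enough moments are controlled to expand further. *)
Lemma model_bound th :
  `|bexp n (fun s => cos (th + lin_form a s + Z s)) - bexp n (fun s => cos (th + lin_form a s))| <=
  l%:R * eps * (1 + B ^+ l) + s2 + S3.
Proof.
have eps0 : 0 <= eps by apply: le_trans heL; exact: expR_ge0.
have B0 : 0 <= B by apply: sumr_ge0.
have Bl0 : 0 <= B ^+ l by rewrite exprn_ge0.
have lr : 1 <= l%:R :> R by rewrite ler1n.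
have Ble : B <= 1 + B ^+ l.
  have [B1|/ltW B1] := leP B 1; first by lra.
  by have := ler_weXn2l B1 l0; rewrite expr1; lra.
have first : eps * B <= l%:R * eps * (1 + B ^+ l).
  rewrite -mulrA mulrCA ler_wpM2l //.
  by have := ler_wpM2l (_ : 0 <= l%:R - 1) (le_trans B0 Ble); lra.
have order2 : `|bexp n (fun s => cos (th + lin_form a s + Z s)) -
    bexp n (fun s => cos (th + lin_form a s))| <= eps * B + g ^+ d / 2.
  have h := @taylor_bexp 1 (fun=> eps * B) _ th.
  rewrite big_ord_recl big_ord0 addr0 E2 in h.
  have e1 : (1`!)%:R = 1 :> R by [].
  have e2 : (2`!)%:R = 2 :> R by [].
  apply: le_trans (h _) _; last by rewrite e1 e2 divr1.
  by case=> // th' _; rewrite (eq_bexp (g := fun s => cos (th' + lin_form a s) * Z s));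
    [exact: first_order|move=> s _; rewrite expr1].
apply: (@le_trans _ _ (l%:R * eps * (1 + B ^+ l) + (s2 + S3))); last by rewrite addrA.
have gd0 : 0 <= g ^+ d by rewrite exprn_ge0 // ltW.
(* For l = 1 the second term is exactly u^2/2. *)
have [l1|l2] : l = 1%N \/ (2 <= l)%N.
  by case: (l) l0 => [//|[|m]] _; [left|right].
  apply: le_trans order2 _; apply: lerD => //.
  have -> : s2 = g ^+ d / 2.
    apply: (mulIf (lt0r_neq0 f0)); apply/eqP.
    rewrite -(eqrXn2 (n := 2)) ?mulr_ge0 ?(ltW f0) ?divr_ge0 // s2E l1.
    have -> : 2`!%:R = 2 :> R by [].
    rewrite divfK // -exprM mulnC exprM gw; apply/eqP; congr (_ ^+ _).
    by rewrite mulr1; ring.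
  by rewrite lerDl.
(* Second-order expansion against S2. *)
have [b1|b1] := ltP b (3 / 10).
  apply: le_trans order2 _; apply: lerD => //.
  apply: (le_trans (y := s2)); last by rewrite lerDl.
  have glam : 6 / 10 * lam <= g.
    have -> : g = lam / (2 * e * b).
      by rewrite /b; field; rewrite !gt_eqF ?expR_gt0.
    have eb0 : 0 < 2 * e * b by apply: mulr_gt0 => //; rewrite mulr_gt0 ?expR_gt0.
    rewrite ler_pdivlMr //.
    have eb : e * b <= 11 / 4 * (3 / 10).
      by apply: ler_pM; rewrite ?expR_ge0 ?(ltW b0) ?expR1_le // ltW.
    have := ler_wpM2l (ltW lam0) eb.
    have -> : 6 / 10 * lam * (2 * e * b) = 12 / 10 * (lam * (e * b)) by ring.
    by move: lam0; generalize lam (e * b) => x y; lra.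
  suff : (g ^+ d / 2 * (l.+1)`!%:R) ^+ 2 <= (s2 * (l.+1)`!%:R) ^+ 2.
    have gf : 0 <= g ^+ d / 2 * (l.+1)`!%:R by rewrite mulr_ge0 // divr_ge0.
    have sf : 0 <= s2 * (l.+1)`!%:R by rewrite mulr_ge0.
    move=> h; have : g ^+ d / 2 * (l.+1)`!%:R <= s2 * (l.+1)`!%:R.
      by move: h; rewrite ler_pXn2r ?nnegrE.
    by rewrite (ler_pM2r f0).
  rewrite s2E.
  set rho := (6 / 10 : R) ^+ l.-1 * l%:R ^+ l.+1.
  have fr : (l.+1)`!%:R <= 2 * rho by exact: fact_le_pow.
  have f2 : 2 <= (l.+1)`!%:R :> R.
    by rewrite ler_nat (leq_trans _ (fact_geq _)).
  have rho1 : 1 <= rho by lra.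
  have base : g ^+ 2 * rho <= lam ^+ 2 * (2 * l%:R * w) ^+ l.+1.
    have -> : 2 * l%:R * w = l%:R * (g / lam) by rewrite /w; field; rewrite gt_eqF.
    have Glam : 6 / 10 <= g / lam by rewrite ler_pdivlMr.
    have El : (g / lam) ^+ l.+1 = (g / lam) ^+ 2 * (g / lam) ^+ l.-1.
      by rewrite -exprD add2n prednK.
    have Eg : lam ^+ 2 * (g / lam) ^+ 2 = g ^+ 2 by field; rewrite gt_eqF.
    rewrite [(l%:R * _) ^+ _]exprMn El [l%:R ^+ _ * _]mulrC [leRHS]mulrA.
    have -> : lam ^+ 2 * ((g / lam) ^+ 2 * (g / lam) ^+ l.-1) * l%:R ^+ l.+1 =
      g ^+ 2 * ((g / lam) ^+ l.-1 * l%:R ^+ l.+1) by rewrite [X in X * _]mulrA Eg mulrA.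
    rewrite ler_wpM2l ?sqr_ge0 // /rho ler_wpM2r ?exprn_ge0 //.
    have h6 : 0 <= 6 / 10 :> R by lra.
    by rewrite lerXn2r ?nnegrE // (le_trans h6).
  apply: le_trans (_ : (g ^+ 2 * rho) ^+ d <= _); last first.
    have G2 : 0 <= g ^+ 2 * rho by rewrite mulr_ge0 ?sqr_ge0 //; lra.
    by rewrite lerXn2r ?nnegrE //; exact: le_trans base.
  have -> : (g ^+ 2 * rho) ^+ d = (g ^+ 2) ^+ d * rho ^+ d by exact: exprMn.
  have -> : (g ^+ d / 2 * (l.+1)`!%:R) ^+ 2 = (g ^+ 2) ^+ d * ((l.+1)`!%:R / 2) ^+ 2.
    by rewrite -[in RHS]exprM mulnC exprM; field.
  apply: ler_wpM2l; first by rewrite exprn_ge0 // sqr_ge0.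
  apply: (le_trans (y := rho ^+ 2)); last first.
    exact: (ler_weXn2l rho1 d2).
  by apply: lerXn2r; rewrite ?nnegrE; lra.
(* Second-order expansion against S3; beyond 20/9 the order 9b/10 is at least 2. *)
have [b2|b2] := leP b (20 / 9).
  apply: le_trans order2 _; apply: lerD => //.
  apply: (le_trans (y := S3)); last by rewrite lerDr.
  apply: (le_trans (y := g ^+ d)); first by lra.
  rewrite /S3; apply: lerXn2r; rewrite ?nnegrE ?(ltW g0) ?mulr_ge0 ?expR_ge0 ?(ltW lam0) //.
  have -> : g = lam / (2 * e * b).
    by rewrite /b; field; rewrite !gt_eqF ?expR_gt0.
  have D0 : 0 < 2 * e * b by apply: mulr_gt0 => //; rewrite mulr_gt0 ?expR_gt0.
  rewrite ler_pM2l // expRN lef_pV2 ?posrE ?expR_gt0 //.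
  by apply: expR_le_2x; rewrite b1 b2.
have b9 : 0 <= 9 / 10 * b by rewrite mulr_ge0 // ltW.
have := truncn_itv b9; set t0 := Num.truncn _ => /andP[t1 t2].
have t02 : (2 <= t0)%N.
  have h0 : 0 <= 9 / 10 :> R by lra.
  have h := ler_wpM2l h0 (ltW b2).
  rewrite -ltnS -(ltr_nat R); apply: le_lt_trans t2; apply: le_trans h; lra.
have expansion r : r.+1%:R <= 9 / 10 * b ->
    `|bexp n (fun s => cos (th + lin_form a s + Z s)) - bexp n (fun s => cos (th + lin_form a s))| <=
    eps * B + (expR (- L) + S3) * (1 - ((r.+1)`!%:R)^-1)
    + bexp n (fun s => `|Z s| ^+ r.+2) / (r.+2)`!%:R.
  move=> hr.
  have h := @taylor_bexp r.+1 (fun j => if j == 1%N then eps * B else expR (- L) + S3) _ th.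
  apply: le_trans (h _) _ => {h}.
    case=> [|j] th' jr /=.
      rewrite (eq_bexp (g := fun s => cos (th' + lin_form a s) * Z s)) => [|s _].
        exact: first_order.
      by rewrite expr1.
    apply: power_moment => //; apply: le_trans hr.
    by rewrite ler_nat.
  rewrite lerD2r big_ord_recl /=.
  have e1 : (1`!)%:R = 1 :> R by [].
  rewrite e1 divr1 lerD2l -mulr_sumr ler_wpM2l ?addr_ge0 ?expR_ge0 //.
  exact: sum_inv_fact.
have eB : eps * B + eps <= l%:R * eps * (1 + B ^+ l).
  have l2r : 2 <= l%:R :> R by rewrite (ler_nat _ 2).
  have -> : l%:R * eps * (1 + B ^+ l) = eps * (l%:R * (1 + B ^+ l)) by ring.
  have -> : eps * B + eps = eps * (B + 1) by ring.
  rewrite ler_wpM2l //.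
  apply: le_trans (_ : 2 * (1 + B ^+ l) <= _); first by lra.
  by rewrite ler_wpM2r //; lra.
(* The expansion stops at the integer part of 9b/10 or at l, whichever is first. *)
have [tl|lt] := leqP t0 l.
  have t0E : t0 = t0.-1.+1 by rewrite prednK // ltnW.
  have := expansion t0.-1; rewrite -t0E => /(_ t1) h; apply: le_trans h _.
  have rt : bexp n (fun s => `|Z s| ^+ t0.+1) <= S3 by exact: remainder_tail.
  have F0 : 0 < (t0`!%:R : R) by rewrite ltr0n fact_gt0.
  have F1 : 0 < ((t0.+1)`!%:R : R) by rewrite ltr0n fact_gt0.
  have FF : ((t0.+1)`!%:R : R)^-1 <= (t0`!%:R)^-1.
    by rewrite lef_pV2 ?posrE // ler_nat leq_fact.
  have i0 : 0 <= (t0`!%:R : R)^-1 by rewrite invr_ge0 ltW.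
  have rem : bexp n (fun s => `|Z s| ^+ t0.+1) / (t0.+1)`!%:R <= S3 * (t0`!%:R)^-1.
    by apply: ler_pM => //; rewrite invr_ge0 ltW.
  have eL := expR_ge0 (- L); have eLi := mulr_ge0 eL i0.
  exact: absorb_tail eB heL rem eLi s20.
have lE : l = l.-1.+1 by rewrite prednK.
have h : l.-1.+1%:R <= 9 / 10 * b.
  by rewrite -lE; apply: le_trans t1; rewrite ler_nat ltnW.
apply: le_trans (expansion _ h) _; rewrite -lE.
have rem := remainder_order l2.
have i0 : 0 <= (l`!%:R : R)^-1 by rewrite invr_ge0.
apply: le_trans (absorb_order s2 eB heL (mulr_ge0 (addr_ge0 (expR_ge0 (- L)) S30) i0)).
by rewrite lerD2l.
Qed.
End Bound.
End Model.

(** * From random variables to bits *)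

Section Law.
Variables (R : realType) (disp : measure_display)
    (Omega : measurableType disp) (P : probability Omega R)
    (p : R).
Hypothesis hp : 0 < p < 1.
Variables (n : nat) (X_ : 'I_n -> {RV P >-> R}).
Hypothesis hbern : forall i, biased_bernoulli P p (X_ i).
Hypothesis hindep : mutually_independent X_.
Local Notation chi := (chi p).

Let bw (b : bool) : R := if b then p else 1 - p.

Let chi_inj : injective chi.
Proof.
have [p0 p1] := andP hp; have q0 : 0 < 1 - p by rewrite subr_gt0.
have t : 0 < chi true by rewrite sqrtr_gt0 divr_gt0.
have f : chi false < 0 by rewrite oppr_lt0 sqrtr_gt0 divr_gt0.
by case; case=> // E; move: t f; rewrite E; lra.
Qed.

(** The closed form of the recursion, to be matched with a partition of the
probability space. *)
Lemma bexp_tuple m (F : seq bool -> R) :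
  bexp p m F = \sum_(c : m.-tuple bool) F c * \prod_(i < m) bw (tnth c i).
Proof.
elim: m F => [|m IH] F /=.
  rewrite (big_pred1 [tuple]) => [|c]; last by apply/esym/eqP; exact: tuple0.
  by rewrite big_ord0 mulr1.
rewrite !IH (reindex (fun bt : bool * m.-tuple bool => [tuple of bt.1 :: bt.2])) /=.
  rewrite -(pair_bigA _ (fun b (t : m.-tuple bool) =>
     F [tuple of b :: t] * \prod_(i < m.+1) bw (tnth [tuple of b :: t] i))) /=.
  rewrite big_bool !mulr_sumr; congr (_ + _); apply: eq_bigr => t _;
    rewrite big_ord_recl tnth0 /= mulrCA; congr (_ * (_ * _));
    by apply: eq_bigr => i _; rewrite tnthS.
exists (fun t : m.+1.-tuple bool => (thead t, [tuple of behead t])).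
  by move=> [b t] _ /=; rewrite theadE; congr (_, _); apply: val_inj.
by move=> t _ /=; rewrite [RHS](tuple_eta t); apply: val_inj.
Qed.

Let A (c : n.-tuple bool) : set Omega :=
  (\bigcap_(i in [set` [set: 'I_n]%SET]) (X_ i @^-1` [set chi (tnth c i)]))%classic.

Let mA c : measurable (A c).
Proof.
apply: fin_bigcap_measurable => [|i _]; first exact: finite_finset.
by rewrite -[X in measurable X]setTI; apply: measurable_funP.
Qed.

Let PA c : P (A c) = (\prod_(i < n) bw (tnth c i))%:E.
Proof.
rewrite /A hindep => [|i _]; last exact: measurable_set1.
rewrite -prodEFin (eq_bigl predT) => [|i]; last by rewrite inE.
apply: eq_bigr => i _; have [ht hf] := hbern i.
by case: (tnth c i).
Qed.

Let tA : trivIset [set` enum {: n.-tuple bool}] A.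
Proof.
move=> c c' _ _ [w [h h']]; apply: eq_from_tnth => i; apply: chi_inj.
by rewrite -(h i) -?(h' i) //= inE.
Qed.

Let D := \big[setU/set0%classic]_(c <- enum {: n.-tuple bool}) A c.

Let mD : measurable D. Proof. exact: bigsetU_measurable. Qed.

Let PD : P D = 1%E.
Proof.
have h := @integral_bigsetU_EFin _ _ _ P _ A (fun=> 1) (enum {: n.-tuple bool}) mA
  (enum_uniq _) tA.
have {h} := h (measurable_cst _); rewrite -/D.
rewrite (integral_cst P mD 1%E) mul1e => ->.
rewrite (eq_bigr (fun c => (\prod_(i < n) bw (tnth c i))%:E)) => [|c _]; last first.
  by rewrite (integral_cst P (mA c) 1%E) mul1e; exact: PA.
rewrite sumEFin big_enum /=; congr (_%:E).
rewrite -[RHS](bexp_cst p n) bexp_tuple.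
by apply: eq_bigr => c _; rewrite mul1r.
Qed.

(** Independence gives each event on which all the variables take prescribed
values its product probability.  These events are disjoint of total mass 1, so the
integral is the sum over them. *)
Lemma expectation_bits (f : Omega -> R) (F : seq bool -> R) :
  measurable_fun setT f ->
  (forall s w, size s = n -> (forall i, X_ i w = chi (nth false s i)) -> f w = F s) ->
  fine 'E_P[f] = bexp p n F.
Proof.
move=> mf fF.
have /measurable_EFinP mfE := mf.
have mDC : measurable (~` D)%classic by exact: measurableC.
suff -> : 'E_P[f]%E = (bexp p n F)%:E by [].
rewrite unlock -(setUv D) integral_setU ?setUv //; last first.
  by apply/disj_setPS; rewrite setICr.
rewrite [X in (_ + X)%E]null_set_integral // ?adde0; last first.
- by rewrite -[LHS]/(P (~` D)%classic) probability_setC // PD subee.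
- exact: measurable_funS mfE.
rewrite (integral_bigsetU_EFin P (F := A)) //; last exact: measurable_funS mfE.
- rewrite bexp_tuple -sumEFin big_enum /=; apply: eq_bigr => c _.
  rewrite (eq_integral (cst (F c)%:E)).
    by rewrite integral_cst // EFinM; congr (_ * _)%E; exact: PA.
  move=> w; rewrite inE => Aw; congr (_%:E); apply: fF; first by rewrite size_tuple.
  by move=> i; rewrite -tnth_nth; apply: (Aw i); rewrite /= inE.
- exact: enum_uniq.
Qed.
End Law.

(** The modulus is attained by the real part after rotation by minus the argument. *)
Lemma complex_norm_le (R : realType) (x y C : R) :
  (forall th, `|cos th * x - sin th * y| <= C) -> `|(x +i* y)%C| <= C%:C%C.
Proof.
move=> h; rewrite normc_def /= lecR.
have [r [w [r0 xE yE]]] := polar_form x y.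
have := h (- w); rewrite cosN sinN mulNr opprK xE yE.
have -> : cos w * (r * cos w) + sin w * (r * sin w) = r * (cos w ^+ 2 + sin w ^+ 2) by ring.
rewrite cos2Dsin2 mulr1 (ger0_norm r0) => hr.
have -> : (r * cos w) ^+ 2 + (r * sin w) ^+ 2 = r ^+ 2.
  by rewrite !exprMn -mulrDr cos2Dsin2 mulr1.
by rewrite sqrtr_sqr ger0_norm.
Qed.

Lemma bexp_cosD (R : realType) (p : R) n (F : seq bool -> R) th :
  bexp p n (fun s => cos (th + F s)) =
  cos th * bexp p n (fun s => cos (F s)) - sin th * bexp p n (fun s => sin (F s)).
Proof.
rewrite -mulNr -!bexpZ -bexpD; apply: eq_bexp => s _.
by rewrite cosD mulNr.
Qed.

Section Transfer.
Variables (R : realType) (disp : measure_display)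
    (Omega : measurableType disp) (P : probability Omega R)
    (p : R).
Hypothesis hp : 0 < p < 1.
Variables (n : nat) (X_ : 'I_n -> {RV P >-> R}).
Hypothesis hbern : forall i, biased_bernoulli P p (X_ i).
Hypothesis hindep : mutually_independent X_.

Lemma measurable_linear (a : 'I_n -> R) :
  measurable_fun setT (fun w => \sum_(i < n) a i * X_ i w).
Proof. by apply: measurable_sum => i; apply: measurable_funM. Qed.

Lemma measurable_multilinear (c : {set 'I_n} -> R) :
  measurable_fun setT (multilinear c X_).
Proof.
apply: measurable_sum => S; apply: measurable_funM => //.
under eq_fun do rewrite -big_enum.
by apply: measurable_prod => i _.
Qed.

Lemma measurable_cosT : measurable_fun setT (@cos R).
Proof. by apply: continuous_measurable_fun; exact: continuous_cos. Qed.

Lemma measurable_sinT : measurable_fun setT (@sin R).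
Proof. by apply: continuous_measurable_fun; exact: continuous_sin. Qed.

Lemma bit_poly_multilinear (c : {set 'I_n} -> R) s w :
  (forall i, X_ i w = chi p (nth false s i)) -> multilinear c X_ w = bit_poly p c s.
Proof.
by move=> h; apply: eq_bigr => S _; congr (_ * _); apply: eq_bigr => i _; rewrite h.
Qed.

Lemma lin_form_linear (a : 'I_n -> R) s w :
  (forall i, X_ i w = chi p (nth false s i)) ->
  \sum_(i < n) a i * X_ i w = lin_form p a s.
Proof. by move=> h; apply: eq_bigr => i _; rewrite h. Qed.

Lemma norm2_bit_poly (c : {set 'I_n} -> R) :
  norm2 P (multilinear c X_) ^+ 2 = bexp p n (fun s => bit_poly p c s ^+ 2).
Proof.
rewrite /norm2 (expectation_bits hp hbern hindep (F := fun s => bit_poly p c s ^+ 2)).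
- by rewrite sqr_sqrtr //; apply: (bexp_ge0 hp) => s; exact: sqr_ge0.
- by apply: measurable_funX; exact: measurable_multilinear.
- by move=> s w _ h; rewrite (bit_poly_multilinear _ h).
Qed.

(** Rotating the difference of characteristic functions by a phase leaves a
difference of expectations of cosines with that phase added. *)
Lemma charfun_diff (a : 'I_n -> R) (c : {set 'I_n} -> R) (t C : R) :
  (forall th,
    `|bexp p n (fun s => cos (th + lin_form p (fun i => t * a i) s + bit_poly p (fun S => t * c S) s)) -
      bexp p n (fun s => cos (th + lin_form p (fun i => t * a i) s))| <= C) ->
  `|charfun P (fun w => \sum_(i < n) a i * X_ i w + multilinear c X_ w) t
    - charfun P (fun w => \sum_(i < n) a i * X_ i w) t| <= C%:C%C.
Proof.
move=> h.
have linE s : t * lin_form p a s = lin_form p (fun i => t * a i) s.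
  by rewrite /lin_form mulr_sumr; apply: eq_bigr => i _; rewrite mulrA.
have polE s : t * bit_poly p c s = bit_poly p (fun S => t * c S) s.
  by rewrite /bit_poly mulr_sumr; apply: eq_bigr => i _; rewrite mulrA.
set l' := lin_form p _ in h linE; set z' := bit_poly p _ in h polE.
have mX := measurable_linear a; have mY := measurable_multilinear c.
have E1 (f : R -> R) : measurable_fun setT f ->
  fine 'E_P[fun w => f (t * (\sum_(i < n) a i * X_ i w + multilinear c X_ w))] =
  bexp p n (fun s => f (l' s + z' s)).
  move=> mf; apply: (expectation_bits hp hbern hindep).
    apply: (measurableT_comp mf); apply: measurable_funM => //.
    exact: measurable_funD.
  move=> s w _ hs; rewrite (lin_form_linear _ hs) (bit_poly_multilinear _ hs).
  by rewrite mulrDr linE polE.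
have E2 (f : R -> R) : measurable_fun setT f ->
  fine 'E_P[fun w => f (t * (\sum_(i < n) a i * X_ i w))] = bexp p n (fun s => f (l' s)).
  move=> mf; apply: (expectation_bits hp hbern hindep).
    by apply: (measurableT_comp mf); apply: measurable_funM.
  by move=> s w _ hs; rewrite (lin_form_linear _ hs) linE.
rewrite /charfun /cexpectation /cexpi /=.
rewrite !(E1 cos measurable_cosT) !(E1 sin measurable_sinT)
  !(E2 cos measurable_cosT) !(E2 sin measurable_sinT).
apply: complex_norm_le => th; have := h th.
rewrite bexp_cosD (_ : (fun s => cos (th + l' s + z' s)) = fun s => cos (th + (l' s + z' s))).
  by rewrite bexp_cosD => hh; apply: le_trans hh; rewrite le_eqVlt; apply/orP; left;
    apply/eqP; congr (`|_|); ring.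
by apply/funext => s; rewrite addrA.
Qed.
End Transfer.

(** * Degenerate cases and the theorem *)

Section Degenerate.
Variables (R : realType) (p : R).
Hypothesis hp : 0 < p < 1.
Variables (n : nat) (a : 'I_n -> R) (c : {set 'I_n} -> R).

Lemma null_diff th : bexp p n (fun s => bit_poly p c s ^+ 2) = 0 ->
  bexp p n (fun s => cos (th + lin_form p a s + bit_poly p c s)) -
  bexp p n (fun s => cos (th + lin_form p a s)) = 0.
Proof.
move=> h; apply/eqP; rewrite subr_eq0; apply/eqP/eq_bexp => s sn.
have /eqP := bexp_eq0 hp (fun s => sqr_ge0 (bit_poly p c s)) h sn.
by rewrite sqrf_eq0 => /eqP ->; rewrite addr0.
Qed.

(** A constant Y only shifts the phase, so each of the two expectations decays on its
own. *)
Lemma constant_diff th : (forall S : {set 'I_n}, c S != 0 -> #|S| = 0%N) ->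
  (forall i, `|a i| <= Num.sqrt (p * (1 - p)) * pi) ->
  `|bexp p n (fun s => cos (th + lin_form p a s + bit_poly p c s)) -
    bexp p n (fun s => cos (th + lin_form p a s))| <=
  2 * expR (- \sum_i (2 * a i ^+ 2 / pi ^+ 2)).
Proof.
move=> hc ha.
have polyE s : bit_poly p c s = c finset.set0.
  rewrite /bit_poly (bigD1 finset.set0) //= big_set0 mulr1 big1 ?addr0 // => S S0.
  have [->|/hc/eqP] := eqVneq (c S) 0; first by rewrite mul0r.
  by rewrite cards_eq0 (negPf S0).
have wave th' : `|bexp p n (fun s => cos (th' + lin_form p a s))| <=
    expR (- \sum_i (2 * a i ^+ 2 / pi ^+ 2)).
  have := monomial_wave hp (fun=> false) a th'.
  rewrite (eq_bexp (g := fun s => cos (th' + lin_form p a s))) => [h|s _].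
    exact: le_trans h (prod_sqrt_loss hp (fun=> false) ha).
  by rewrite /monomial big1 ?mulr1.
rewrite (eq_bexp (f := fun s => cos (th + lin_form p a s + bit_poly p c s))
  (g := fun s => cos (th + c finset.set0 + lin_form p a s))) => [|s _]; last first.
  by rewrite polyE addrAC.
by apply: le_trans (ler_normB _ _) _; rewrite mulr2n mulrDl !mul1r; apply: lerD.
Qed.
End Degenerate.

Theorem theorem3 (R : realType) (disp : measure_display)
    (Omega : measurableType disp) (P : probability Omega R)
    (p : R) (hp : 0 < p < 1)
    (n : nat) (X_ : 'I_n -> {RV P >-> R})
    (hbern : forall i, biased_bernoulli P p (X_ i))
    (hindep : mutually_independent X_)
    (a : 'I_n -> R)
    (d : nat) (Yhat : {set 'I_n} -> R)
    (hdeg : mdegree Yhat = d)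
    (hdeg1 : forall S : {set 'I_n}, #|S| = 1%N -> Yhat S = 0)
    (T delta : R)
    (hT : \sum_(i < n) a i ^+ 2 = T)
    (hdelta0 : 0 <= delta)
    (hdelta : forall i, a i ^+ 2 <= delta)
    (l : nat) (hl : (0 < l)%N) (t : R) :
  let lambda := Num.min p (1 - p) in
  let e := expR 1 : R in
  let X := fun w => \sum_(i < n) a i * X_ i w in
  let Y := multilinear Yhat X_ in
  let eta := norm2 P Y in
  let epsilon :=
    expR (- (2 * t ^+ 2 * (T - delta * d%:R * l%:R) / pi ^+ 2)) in
  let phiX := charfun P X t in
  let phi := charfun P (fun w => X w + Y w) t in
  (* the inverses below are taken in \bar R, where 0^-1 = +oo *)
  (`|t|%:E <
     Order.min
       ((Num.sqrt (p * (1 - p)) * pi)%:E * ((Num.sqrt delta)%:E)^-1)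
       (((2 * e) `^ (l%:R / 2) * lambda `^ (- (l%:R / 2)))%:E
          * (eta%:E)^-1))%E ->
  `|phi - phiX| <=
    (l%:R * epsilon * (1 + `|t * spectral_norm1 Yhat| ^+ l)
     + `|t * eta| ^+ l.+1 / (l.+1)`!%:R
         * l%:R `^ (d%:R * l.+1%:R / 2)
         * lambda `^ (d%:R * ((1 - l%:R) / 2))
     + lambda ^+ d * exp_decay d (d%:R * lambda / (2 * e)) (t * eta)
     + `|t * eta| `^ (l.+1%:R / 2)
         * lambda `^ ((3 * d%:R - l%:R) / 4)
         * l.+1%:R
         * exp_decay d (d%:R * lambda / (4 * e)) (t * eta))%:C%C.
Proof.
move=> lambda e X Y eta epsilon phiX phi ht.
have lam0 : 0 < lambda by exact: lam_gt0.
set S1 := l%:R * epsilon * _; set S2 := _ * lambda `^ (d%:R * ((1 - l%:R) / 2)).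
set S3 := lambda ^+ d * _; set S4 := _ * exp_decay d (d%:R * lambda / (4 * e)) _.
have decay0 c : 0 <= exp_decay d c (t * eta).
  by rewrite /exp_decay; case: ifP => // _; exact: expR_ge0.
have S20 : 0 <= S2.
  by rewrite mulr_ge0 ?powR_ge0 // mulr_ge0 ?powR_ge0 // mulr_ge0 ?invr_ge0 // exprn_ge0.
have S30 : 0 <= S3 by rewrite mulr_ge0 // exprn_ge0 // ltW.
have S40 : 0 <= S4.
  by rewrite mulr_ge0 // mulr_ge0 // mulr_ge0 // powR_ge0.
have eps0 : 0 < epsilon by exact: expR_gt0.
have S10 : 0 <= S1.
  by rewrite /S1 mulr_ge0 ?mulr_ge0 ?(ltW eps0) // addr_ge0 ?exprn_ge0.
have ha i : `|t * a i| <= Num.sqrt (p * (1 - p)) * pi.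
  move: ht; rewrite lt_min => /andP[+ _]; rewrite inver sqrtr_eq0.
  have ai : `|a i| <= Num.sqrt delta by rewrite -sqrtr_sqr ler_wsqrtr.
  (* For delta = 0 the bound on t is infinite, but then all a i vanish. *)
  case: ifP => [d0 _|/negbT d0].
    have a0 : a i = 0.
      apply/eqP; rewrite -sqrf_eq0 eq_le sqr_ge0 andbT.
      exact: le_trans (hdelta i) d0.
    by rewrite a0 mulr0 normr0 mulr_ge0 ?sqrtr_ge0 // ltW // pi_gt0.
  rewrite -EFinM lte_fin => tlt.
  have dp : 0 < Num.sqrt delta by rewrite sqrtr_gt0 ltNge.
  rewrite normrM; apply: le_trans (ler_wpM2l _ ai) _ => //.
  by rewrite -ler_pdivlMr // ltW.
have hc (S : {set 'I_n}) : t * Yhat S != 0 -> (#|S| <= d)%N.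
  rewrite mulf_eq0 negb_or => /andP[_ YS]; rewrite -hdeg /mdegree.
  exact: (leq_bigmax_cond (P := fun S => Yhat S != 0) (F := fun S : {set 'I_n} => #|S|)).
have uE : bexp p n (fun s => bit_poly p (fun S => t * Yhat S) s ^+ 2) = (t * eta) ^+ 2.
  rewrite exprMn (norm2_bit_poly hp hbern hindep) -bexpZ; apply: eq_bexp => s _.
  by rewrite -exprMn; congr (_ ^+ 2); rewrite /bit_poly mulr_sumr; apply: eq_bigr => S _;
    rewrite mulrA.
have pi0 : 0 < pi :> R by exact: pi_gt0.
have LE : \sum_i (2 * (t * a i) ^+ 2 / pi ^+ 2) = 2 * t ^+ 2 * T / pi ^+ 2.
  rewrite -hT mulr_sumr mulr_suml; apply: eq_bigr => i _.
  by rewrite exprMn mulrA.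
have L0 : 0 <= \sum_i (2 * (t * a i) ^+ 2 / pi ^+ 2).
  by apply: sumr_ge0 => i _; rewrite divr_ge0 ?sqr_ge0 // mulr_ge0 ?sqr_ge0.
have heps (S : {set 'I_n}) : (#|S| <= d)%N ->
    expR (- \sum_(i | i \notin S) (2 * (t * a i) ^+ 2 / pi ^+ 2)) <= epsilon.
  move=> Sd; rewrite ler_expR lerN2.
  have -> : \sum_(i | i \notin S) (2 * (t * a i) ^+ 2 / pi ^+ 2) =
      2 * t ^+ 2 * (\sum_(i | i \notin S) a i ^+ 2) / pi ^+ 2.
    rewrite mulr_sumr mulr_suml; apply: eq_bigr => i _.
    by rewrite exprMn mulrA.
  apply: ler_wpM2r; first by rewrite invr_ge0 sqr_ge0.
  apply: ler_wpM2l; first by rewrite mulr_ge0 // sqr_ge0.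
  have : T = \sum_(i in S) a i ^+ 2 + \sum_(i | i \notin S) a i ^+ 2.
    by rewrite -hT (bigID (fun i => i \in S)).
  (* At most d variables are dropped, each of weight at most delta, and l >= 1. *)
  have : \sum_(i in S) a i ^+ 2 <= delta * d%:R * l%:R.
    apply: le_trans (_ : \sum_(i in S) delta <= _); first by apply: ler_sum.
    rewrite sumr_const -[leLHS]mulr_natr -[leRHS]mulrA ler_wpM2l // -natrM ler_nat.
    by apply: leq_trans Sd _; rewrite leq_pmulr.
  by move=> h1 h2; rewrite h2 lerBlDr [leLHS]addrC lerD2l.
have heL : expR (- \sum_i (2 * (t * a i) ^+ 2 / pi ^+ 2)) <= epsilon.
  apply: le_trans (heps finset.set0 _); last by rewrite cards0.
  rewrite le_eqVlt; apply/orP; left; apply/eqP; congr (expR (- _)).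
  by apply: eq_bigl => i; rewrite inE.
apply: (charfun_diff hp hbern hindep) => th.
set Delta := `|_|.
suff : Delta <= S1 + S2 + S3 by move=> h; rewrite (le_trans h) // lerDl.
have [u0|un0] := eqVneq (t * eta) 0.
  rewrite /Delta null_diff ?normr0 ?addr_ge0 //.
  by rewrite uE u0 expr0n.
have [d0|d0] := posnP d.
  have S3E : S3 = 1.
    rewrite /S3 /exp_decay (negPf un0) d0 expr0 mul1r !mul0r oppr0 expR0 //.
  have hc0 (S : {set 'I_n}) : t * Yhat S != 0 -> #|S| = 0%N.
    by move=> /hc; rewrite d0 leqn0 => /eqP.
  have := constant_diff hp th hc0 ha; rewrite -/Delta.
  have : expR (- \sum_i (2 * (t * a i) ^+ 2 / pi ^+ 2)) <= 1.
    by rewrite expR_le1 oppr_le0.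
  have : epsilon <= S1.
    rewrite /S1 -[leLHS]mul1r -[leLHS]mulr1; apply: ler_pM => //.
    - by rewrite mul1r ltW.
    - by rewrite ler_pM2r // ler1n.
    - by rewrite lerDl exprn_ge0.
  rewrite S3E; lra.
(* A degree of 1 would be reached on a singleton, where the coefficient is 0. *)
have d2 : (2 <= d)%N.
  rewrite ltn_neqAle d0 andbT eq_sym; apply/eqP => d1.
  have : (mdegree Yhat <= 0)%N; last by rewrite hdeg d1.
  apply/bigmax_leqP => S YS.
  have : (#|S| <= mdegree Yhat)%N.
    exact: (leq_bigmax_cond (P := fun S => Yhat S != 0) (F := fun S : {set 'I_n} => #|S|)).
  rewrite hdeg d1 leq_eqVlt => /orP[/eqP/hdeg1 Y0|//].
  by rewrite Y0 eqxx in YS.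
pose u := `|t * eta|.
have u0 : 0 < u by rewrite normr_gt0.
pose g := u `^ (2 / d%:R).
have g0 : 0 < g by exact: powR_gt0.
have dn0 : d%:R != 0 :> R by rewrite pnatr_eq0 -lt0n.
have gd : g ^+ d = u ^+ 2.
  by rewrite -powR_mulrn ?(ltW g0) // -powRrM divfK // powR_mulrn ?ltW.
have gE : g ^+ d = bexp p n (fun s => bit_poly p (fun S => t * Yhat S) s ^+ 2).
  by rewrite gd uE real_normK ?num_real.
have s2E : (S2 * (l.+1)`!%:R) ^+ 2 =
    (lambda ^+ 2 * (2 * l%:R * (g / (2 * lambda))) ^+ l.+1) ^+ d.
  have lr0 : 0 < l%:R :> R by rewrite ltr0n.
  have pl : (l%:R `^ (d%:R * l.+1%:R / 2)) ^+ 2 = (l%:R ^+ l.+1) ^+ d :> R.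
    rewrite -powR_mulrn ?powR_ge0 // -powRrM divfK //.
    by rewrite mulrC powRrM !powR_mulrn ?exprn_ge0 // ltW.
  have pla : (lambda `^ (d%:R * ((1 - l%:R) / 2))) ^+ 2 * (lambda ^+ l.+1) ^+ d =
      (lambda ^+ 2) ^+ d.
    rewrite -powR_mulrn ?powR_ge0 // -powRrM.
    have -> : d%:R * ((1 - l%:R) / 2) * 2%:R = d%:R * (1 - l%:R) :> R by field.
    rewrite -!exprM -!powR_mulrn ?(ltW lam0) // -powRD; last by rewrite (gt_eqF lam0) implybT.
    by congr (_ `^ _); rewrite !natrM -natr1; ring.
  have f0 : (l.+1)`!%:R != 0 :> R by rewrite pnatr_eq0 -lt0n fact_gt0.
  have -> : S2 * (l.+1)`!%:R = u ^+ l.+1 * l%:R `^ (d%:R * l.+1%:R / 2) *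
      lambda `^ (d%:R * ((1 - l%:R) / 2)).
    by rewrite /S2 -/u; field.
  have -> : 2 * l%:R * (g / (2 * lambda)) = l%:R * (g / lambda).
    by field; rewrite gt_eqF.
  rewrite [(l%:R * _) ^+ _]exprMn expr_div_n.
  have -> : (lambda ^+ 2 * (l%:R ^+ l.+1 * (g ^+ l.+1 / lambda ^+ l.+1))) ^+ d =
    (lambda ^+ 2) ^+ d * (l%:R ^+ l.+1) ^+ d * (g ^+ l.+1) ^+ d / (lambda ^+ l.+1) ^+ d.
    by rewrite !(exprMn d) exprVn; ring.
  rewrite -pla -pl (_ : (g ^+ l.+1) ^+ d = (u ^+ l.+1) ^+ 2); last first.
    by rewrite -exprM mulnC exprM gd -exprM mulnC exprM.
  rewrite !(exprMn 2); field.
  by rewrite !expf_neq0 // gt_eqF.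
have S3E : S3 = (lambda * expR (- (lambda / (2 * expR 1 * g)))) ^+ d.
  rewrite /S3 /exp_decay (negPf un0) [RHS]exprMn -expRM_natl; congr (_ * expR _).
  rewrite -/u mulNr powRN -/g -/e; field.
  by rewrite !gt_eqF ?expR_gt0.
have := model_bound hp hc ha heps g0 gE S20 s2E d2 hl heL th.
rewrite -/Delta -S3E; congr (_ <= _); congr (l%:R * epsilon * (1 + _ ^+ l) + S2 + S3).
rewrite normrM /spectral_norm1 (ger0_norm (sumr_ge0 _ _)) // mulr_sumr.
by apply: eq_bigr => S _; rewrite normrM.
Qed.
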